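(* Let $W$ be a (possibly infinite) Coxeter group, let $\gamma=s_1s_2\cdots s_n$ be a Coxeter element of $W$, and let $u,v\in C_\gamma$ with $u\leq_\gamma v$. Then the map $\lambda_\gamma:\mathcal{E}(C_\gamma)\to\mathbb{N}$, $\lambda_\gamma(x,y)=\min\bigl(\alpha_\gamma(y)\smallsetminus\alpha_\gamma(x)\bigr)$ (restricted to the covering relations of $[u,v]_\gamma$) is an EL-labeling for the closed interval $[u,v]_\gamma$.
   Context: **Coxeter groups and weak order.** $(W,S)$ is a Coxeter system with finite set of generators $S=\{s_1,\dots,s_n\}$, $\ell_S$ is the word length. The (right) weak order is $u\leq_S v$ iff $\ell_S(v)=\ell_S(u)+\ell_S(u^{-1}v)$. It is a meet-semilattice in which every closed interval is finite. **Sortable elements.** A Coxeter element is a product of all generators, each used exactly once, in some order; number the generators so that $\gamma=s_1s_2\cdots s_n$, and fix this reduced word for $\gamma$. Let $\gamma^\infty=s_1\cdots s_n\,|\,s_1\cdots s_n\,|\cdots$ be the half-infinite word obtained by repeating $s_1\cdots s_n$ (dividers $|$ have no effect). The $\gamma$-sorting word of $w\in W$ is the reduced word for $w$ which is lexicographically first as a subword of $\gamma^\infty$. Write it as $w=s_1^{\delta_{1,1}}\cdots s_n^{\delta_{1,n}}|\cdots|s_1^{\delta_{l,1}}\cdots s_n^{\delta_{l,n}}$ with $\delta_{i,j}\in\{0,1\}$; the $i$-th block is $b_i=\{s_j\mid\delta_{i,j}=1\}$. The element $w$ is $\gamma$-sortable iff $b_1\supseteq b_2\supseteq\cdots\supseteq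 b_l$. The set of positions of $w$ is $\alpha_\gamma(w)=\{(i-1)n+j\mid\delta_{i,j}=1\}\subseteq\mathbb{N}$. **Cambrian semilattice.** $C_\gamma$ is the set of all $\gamma$-sortable elements of $W$ with the order $\leq_\gamma$ induced from $\leq_S$; it is a known fact that it is a sub-semilattice of the weak order, closed under meets of nonempty sets and joins of sets with an upper bound. $\mathcal{E}(C_\gamma)$ denotes the set of covering relations of $C_\gamma$, and $[u,v]_\gamma$ the closed interval in $C_\gamma$. **EL-labelings.** For a finite bounded poset $P$, an edge-labeling $\lambda:\mathcal{E}(P)\to\mathbb{N}$ and a saturated chain $c:p_0\lessdot\cdots\lessdot p_s$, let $\lambda(c)=(\lambda(p_0,p_1),\dots,\lambda(p_{s-1},p_s))$; $c$ is rising if $\lambda(c)$ is strictly increasing. Words over $\mathbb{N}$ are compared lexicographically: $(p_1,\dots,p_s)\leq(q_1,\dots,q_t)$ iff either $s\leq t$ and $p_i=q_i$ for $1\le i\le s$, or $p_i<q_i$ for the least $i$ with $p_i\neq q_i$. A maximal chain is lexicographically first if its label word is $\leq$ that of every other maximal chain. $\lambda$ is an EL-labeling of $P$ if in every closed interval $[x,y]$ of $P$ there is a unique rising maximal chain, and it is lexicographically first among all maximal chains of $[x,y]$. *)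

(* Defs.v *)
From HB Require Import structures.
From mathcomp Require Import all_boot all_order.
From mathcomp Require Import boolp classical_sets functions cardinality.

Set Implicit Arguments.
Unset Strict Implicit.
Unset Printing Implicit Defensive.

Local Open Scope classical_set_scope.
Local Open Scope nat_scope.

(* 0 when A is empty *)
Definition min_nat (A : set nat) : nat :=
  xget 0 [set m | A m /\ forall k, A k -> m <= k].

Lemma min_natP (A : set nat) :
  A !=set0 -> A (min_nat A) /\ forall k, A k -> min_nat A <= k.
Proof.
move=> [a Aa].
apply: (@xgetPex _ 0 [set m | A m /\ forall k, A k -> m <= k]).
have exA : exists k, `[< A k >] by exists a; apply/asboolP.
case: (ex_minnP exA) => m /asboolP Am minm; exists m; split=> // k Ak.
by apply: minm; apply/asboolP.
Qed.

(* The lexicographic order of seqlexi: a proper prefix is smaller than the word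
   it is a prefix of. *)
Definition lex_le (s t : seq nat) : bool := ((s : seqlexi nat) <= t)%O.

(** Posets given by a carrier P and a relation le, and EL-labelings *)

Definition interval (T : Type) (P : set T) (le : rel T) (x y : T) : set T :=
  [set z | [/\ P z, le x z & le z y]].

Record fin_bounded_poset (T : Type) (P : set T) (le : rel T) : Prop := {
  fbp_refl : forall x, P x -> le x x;
  fbp_anti : forall x y, P x -> P y -> le x y -> le y x -> x = y;
  fbp_trans : forall x y z, P x -> P y -> P z -> le x y -> le y z -> le x z;
  fbp_finite : finite_set P;
  fbp_bot : exists2 b, P b & forall x, P x -> le b x;
  fbp_top : exists2 t, P t & forall x, P x -> le x t
}.

Definition covers (T : Type) (P : set T) (le : rel T) (x y : T) : Prop :=
  [/\ P x, P y, le x y, x <> y &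
      forall z, P z -> le x z -> le z y -> z = x \/ z = y].

(* The chain x = p_0, p_1, ..., p_s is given by x and c = [:: p_1; ...; p_s]. *)
Definition maximal_chain (T : Type) (P : set T) (le : rel T) (x y : T)
    (c : seq T) : Prop :=
  path (fun a b => `[< covers (interval P le x y) le a b >]) x c
  /\ last x c = y.

Definition label_word (T : Type) (lam : T -> T -> nat) (x : T) (c : seq T) :
  seq nat := pairmap lam x c.

Definition rising (T : Type) (lam : T -> T -> nat) (x : T) (c : seq T) : bool :=
  sorted ltn (label_word lam x c).

(* lam is total on T * T, but only its values on the covering relations of the
   poset are used. *)
Definition EL_labeling (T : Type) (P : set T) (le : rel T)
    (lam : T -> T -> nat) : Prop :=
  fin_bounded_poset P le /\
  forall x y, P x -> P y -> le x y ->
  exists c, [/\ maximal_chain P le x y c,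
                rising lam x c,
                forall c', maximal_chain P le x y c' -> rising lam x c' ->
                  c' = c
              & forall c', maximal_chain P le x y c' ->
                  lex_le (label_word lam x c) (label_word lam x c')].

(** Coxeter systems *)

(* The congruence on words generated by (s_i s_j)^(m i j) = 1, where m i j = 0
   stands for infinity (the relation is then void). When m i i = 1 every
   generator is its own inverse, so that the quotient monoid is the group
   presented by these relations, and formal inverses are not needed. *)
Inductive cox_congr (n : nat) (m : 'I_n -> 'I_n -> nat) :
    seq 'I_n -> seq 'I_n -> Prop :=
| cox_congr_refl a : cox_congr m a a
| cox_congr_sym a b : cox_congr m a b -> cox_congr m b a
| cox_congr_trans a b c :
    cox_congr m a b -> cox_congr m b c -> cox_congr m a c
| cox_congr_rel a b i j :
    cox_congr m (a ++ flatten (nseq (m i j) [:: i; j]) ++ b) (a ++ b).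

Definition word_prod (W : groupType) (n : nat) (s : 'I_n -> W) (a : seq 'I_n) :
  W := (\prod_(i <- a) s i)%g.

(* cox_gen 0, ..., cox_gen (n - 1) are the generators s_1, ..., s_n; their
   numbering records the chosen reduced word s_1 ... s_n of the Coxeter
   element. *)
Record coxeter_system (W : groupType) (n : nat) := CoxeterSystem {
  cox_gen : 'I_n -> W;
  cox_mx : 'I_n -> 'I_n -> nat;
  cox_mx_diag : forall i, cox_mx i i = 1;
  cox_mx_offdiag : forall i j, i != j -> cox_mx i j != 1;
  cox_mx_sym : forall i j, cox_mx i j = cox_mx j i;
  cox_generated : forall w, exists a, word_prod cox_gen a = w;
  cox_presented : forall a b,
    word_prod cox_gen a = word_prod cox_gen b <-> cox_congr cox_mx a b
}.

Definition cox_length (W : groupType) (n : nat) (C : coxeter_system W n)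
    (w : W) : nat :=
  min_nat [set size a | a in [set a | word_prod (cox_gen C) a = w]].

Definition weak_le (W : groupType) (n : nat) (C : coxeter_system W n) : rel W :=
  fun u v => cox_length C v == cox_length C u + cox_length C (u^-1 * v)%g.

(** Sorting words *)

(* (i, j) denotes the letter j of the block i of the half-infinite word, both
   counted from 0; pos is its position, counted from 1. *)
Definition pos (n : nat) (p : nat * 'I_n) : nat := p.1 * n + p.2.+1.

(* A subword of the half-infinite word is given by the list of the occurrences
   of its letters, in increasing order of position. *)
Definition reduced_subword (W : groupType) (n : nat) (C : coxeter_system W n)
    (w : W) (d : seq (nat * 'I_n)) : Prop :=
  [/\ sorted ltn (map (@pos n) d),
      word_prod (cox_gen C) (map snd d) = w
    & size d = cox_length C w].

Definition is_sorting_word (W : groupType) (n : nat) (C : coxeter_system W n)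
    (w : W) (d : seq (nat * 'I_n)) : Prop :=
  reduced_subword C w d /\
  forall d', reduced_subword C w d' ->
    lex_le (map (@pos n) d) (map (@pos n) d').

(* The default [::] is never used, see sorting_wordP. *)
Definition sorting_word (W : groupType) (n : nat) (C : coxeter_system W n)
    (w : W) : seq (nat * 'I_n) :=
  xget [::] [set d | is_sorting_word C w d].

Definition block (W : groupType) (n : nat) (C : coxeter_system W n) (w : W)
    (i : nat) : {set 'I_n} :=
  [set j | (i, j) \in sorting_word C w]%SET.

Definition sortable (W : groupType) (n : nat) (C : coxeter_system W n)
    (w : W) : Prop :=
  forall i, block C w i.+1 \subset block C w i.

Definition alpha (W : groupType) (n : nat) (C : coxeter_system W n) (w : W) :
  set nat := [set k | k \in map (@pos n) (sorting_word C w)].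

Definition cambrian (W : groupType) (n : nat) (C : coxeter_system W n) :
  set W := [set w | sortable C w].

Definition cambrian_label (W : groupType) (n : nat) (C : coxeter_system W n)
    (x y : W) : nat := min_nat (alpha C y `\` alpha C x).

Lemma lex_min_exists (k : nat) (A : set (seq nat)) :
  A !=set0 -> (forall a, A a -> size a = k) ->
  exists2 a, A a & forall b, A b -> lex_le a b.
Proof.
elim: k A => [|k IHk] A [a Aa] sizeA.
  exists a => // b Ab; rewrite (size0nil (sizeA a Aa)) (size0nil (sizeA b Ab)).
  exact: Order.POrderTheory.lexx.
pose H : set nat := [set x | exists r, A (x :: r)].
have [] := @min_natP H.
  by case: a Aa => [/sizeA//|x r Axr]; exists x; exists r.
set x := min_nat H => -[r Axr] minx.
have [||t Axt mint] := IHk [set t | A (x :: t)]; first by exists r.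
  by move=> t /sizeA[].
exists (x :: t) => // -[|y b] Ab; first by have := sizeA _ Ab.
have lexy : x <= y by apply: minx; exists b.
change ((x <= y) && ((y <= x) ==> lex_le t b)).
rewrite lexy; apply/implyP => leyx.
have exy : x = y by apply/eqP; rewrite eqn_leq lexy.
by apply: mint; rewrite /= exy.
Qed.

Lemma sorting_wordP (W : groupType) (n : nat) (C : coxeter_system W n) (w : W) :
  is_sorting_word C w (sorting_word C w).
Proof.
apply: (@xgetPex _ [::] [set d | is_sorting_word C w d]).
have [||p [d redd <-] mind] :=
  @lex_min_exists (cox_length C w)
    [set map (@pos n) d | d in reduced_subword C w];
  last first.
- by exists d; split=> // d' redd'; apply: mind; exists d'.
- by move=> _ [d [_ _ szd] <-]; rewrite size_map.
have [] := @min_natP [set size a | a in [set a | word_prod (cox_gen C) a = w]].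
  by have [a aw] := cox_generated C w; exists (size a); exists a.
move=> -[a aw sza] _.
pose d := zip (iota 0 (size a)) a.
exists (map (@pos n) d); exists d => //; split.
- rewrite {}/d; move: 0 => i; elim: a i {aw sza} => //= x [|y a] IHa i //=.
  rewrite /pos /= mulSn; apply/andP; split; last exact: IHa i.+1.
  by rewrite !addnS ltnS [n + _]addnC -addnA ltn_add2l ltn_addr.
- by rewrite -/(unzip2 d) unzip2_zip // size_iota.
- by rewrite size_zip size_iota minnn sza.
Qed.

(* Main.v *)
From mathcomp Require Import all_boot all_order all_algebra.
From mathcomp Require Import boolp classical_sets functions cardinality.
From mathcomp Require Import reals Rstruct trigo.
From mathcomp Require Import zify ring lra.
Require Import Defs.

(** Sortability is translated into a condition on inversions (Reading and
    Speyer): call [w] aligned when, for every inversion [b = a1 b1 + a2 b2] that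
    is a positive combination of positive roots with [omega b1 b2 > 0], the root
    [b1] is an inversion too; [omega] is the skew form of the Coxeter element,
    i.e. the antisymmetric part of its Euler form. Rotating the Coxeter element
    by its initial letter [s] transports both forms along [s], so aligned and
    sortable elements obey the same recursion along the half-infinite word: strip
    [s] if it is a left descent, and otherwise drop [s] altogether.

    The crucial point is that the join of two aligned elements is aligned. It
    reduces to the join [z] of the initial letter [s] and an element [x] of the
    parabolic subgroup without [s]. Working in the rotated order, in which [s]
    comes last, [z] is aligned by induction on the length; since the root of
    [s] is that of a lower cover of [z], the reflection [s] permutes the other
    inversions of [z], and this turns alignment for the rotated order into
    alignment for the original one. Moreover [z] has no inversion in that parabolic subgroup besides those of
    [x]: otherwise, for the root [t] of a suitable lower cover, the inversions [b]
    of [z] with [euler b t <= 0] would form a smaller upper bound.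

    So when [s] is below [y] but not below [x], the join of [x] and [s] covers [x]
    in the Cambrian semilattice, this is the only cover of [x] below [y] whose
    label is the first position, and every maximal chain from [x] to [y] has
    exactly one such label; induction along the half-infinite word yields the
    unique rising chain. *)

Set Implicit Arguments.
Unset Strict Implicit.
Unset Printing Implicit Defensive.

Import Order.TTheory GRing.Theory Num.Theory.
Local Open Scope ring_scope.

(** * Words and length *)

Section Length.
Variables (W : groupType) (n : nat) (C : coxeter_system W n).
Local Open Scope group_scope.
Local Notation g := (cox_gen C).
Local Notation wp := (word_prod g).
Local Notation ell := (cox_length C).

Lemma word_prod_nil : wp [::] = 1.
Proof. by rewrite /word_prod big_nil. Qed.

Lemma word_prod_cons i a : wp (i :: a) = g i * wp a.
Proof. by rewrite /word_prod big_cons. Qed.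

Lemma word_prod_cat a b : wp (a ++ b) = wp a * wp b.
Proof. by rewrite /word_prod big_cat. Qed.

Lemma word_prod_rcons a i : wp (rcons a i) = wp a * g i.
Proof. by rewrite -cats1 word_prod_cat word_prod_cons word_prod_nil mulg1. Qed.

Lemma gen_mul_order i j : (g i * g j) ^+ cox_mx C i j = 1.
Proof.
rewrite -word_prod_nil.
have -> : (g i * g j) ^+ cox_mx C i j =
          wp (flatten (nseq (cox_mx C i j) [:: i; j])).
  elim: (cox_mx C i j) => [|m IHm]; first by rewrite expg0 word_prod_nil.
  by rewrite expgS /= !word_prod_cons IHm mulgA.
apply/(cox_presented C); have := cox_congr_rel (cox_mx C) [::] [::] i j.
by rewrite /= cats0.
Qed.

Lemma gen_mulK i : g i * g i = 1.
Proof. by have := gen_mul_order i i; rewrite cox_mx_diag expg1. Qed.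

Lemma genV i : (g i)^-1 = g i.
Proof. by apply: (mulgI (g i)); rewrite mulgV gen_mulK. Qed.

Lemma gen_mulKg i w : g i * (g i * w) = w.
Proof. by rewrite mulgA gen_mulK mul1g. Qed.

Lemma mulgen_K i w : w * g i * g i = w.
Proof. by rewrite -mulgA gen_mulK mulg1. Qed.

Lemma wordV a : (wp a)^-1 = wp (rev a).
Proof.
elim: a => [|i a IHa]; first by rewrite word_prod_nil invg1.
by rewrite word_prod_cons invgM IHa rev_cons word_prod_rcons genV.
Qed.

Lemma length_word a : (ell (wp a) <= size a)%N.
Proof.
have [|_] := @min_natP [set size b | b in [set b | wp b = wp a]]%classic.
  by exists (size a); exists a.
by apply; exists a.
Qed.

Lemma reduced_word w : exists2 a, wp a = w & size a = ell w.
Proof.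
have [|] := @min_natP [set size b | b in [set b | wp b = w]]%classic.
  by have [a aw] := cox_generated C w; exists (size a); exists a.
by move=> [a aw sza] _; exists a.
Qed.

Lemma length1 : ell 1 = 0%N.
Proof. by apply/eqP; rewrite -leqn0 -word_prod_nil length_word. Qed.

Lemma length_eq0 w : ell w = 0%N -> w = 1.
Proof.
by have [a <- <-] := reduced_word w => /size0nil->; rewrite word_prod_nil.
Qed.

Lemma lengthV w : ell w^-1 = ell w.
Proof.
have leV v : (ell v^-1 <= ell v)%N.
  have [a <- <-] := reduced_word v.
  by rewrite wordV (leq_trans (length_word _)) ?size_rev.
by apply/eqP; rewrite eqn_leq leV -{1}[w]invgK leV.
Qed.

Lemma lengthM u v : (ell (u * v) <= ell u + ell v)%N.
Proof.
have [a <- <-] := reduced_word u; have [b <- <-] := reduced_word v.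
by rewrite -word_prod_cat -size_cat length_word.
Qed.

Lemma length_gen_le i : (ell (g i) <= 1)%N.
Proof. by have := length_word [:: i]; rewrite word_prod_cons word_prod_nil mulg1. Qed.

(** Every defining relator has even length, so the parity of a word depends only on its product;
    hence a generator changes the length by exactly one. *)
Lemma cox_congr_parity a b : cox_congr (cox_mx C) a b -> odd (size a) = odd (size b).
Proof.
elim=> // [{}a {}b c _ -> _ -> //|{}a {}b i j].
rewrite !size_cat !oddD size_flatten /shape map_nseq sumn_nseq /=.
by rewrite oddM /=; case: (odd _); case: (odd _).
Qed.

Lemma length_parity a : odd (ell (wp a)) = odd (size a).
Proof.
have [b eqab <-] := reduced_word (wp a).
by apply: cox_congr_parity; apply/(cox_presented C).
Qed.

Lemma length_gen_mul i w :
  ell (g i * w) = (ell w).+1 \/ ell w = (ell (g i * w)).+1.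
Proof.
have leS v : (ell (g i * v) <= (ell v).+1)%N.
  by rewrite (leq_trans (lengthM _ _)) // -add1n leq_add2r length_gen_le.
have := leS w; have := leS (g i * w); rewrite gen_mulKg.
have : odd (ell (g i * w)) = ~~ odd (ell w).
  have [a <- _] := reduced_word w.
  by rewrite -word_prod_cons !length_parity.
lia.
Qed.

Lemma length_mul_gen i w :
  ell (w * g i) = (ell w).+1 \/ ell w = (ell (w * g i)).+1.
Proof.
have := length_gen_mul i w^-1.
by rewrite -(lengthV (g i * _)) invgM invgK genV lengthV.
Qed.

Lemma left_descent w : w <> 1 -> exists i, ell w = (ell (g i * w)).+1.
Proof.
have [[|i a] <- sza] := reduced_word w; first by rewrite word_prod_nil.
move=> _; exists i; have := length_word a.
have := length_gen_mul i (wp (i :: a)).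
rewrite -sza word_prod_cons gen_mulKg /= => -[->|->] //; lia.
Qed.

Lemma right_descent w : w <> 1 -> exists i, ell w = (ell (w * g i)).+1.
Proof.
move=> w1; have [|i dw] := @left_descent w^-1.
  by move=> eqV; apply: w1; rewrite -[w]invgK eqV invg1.
exists i; rewrite -(lengthV w) dw -(lengthV (w * g i)).
by rewrite invgM genV.
Qed.

(** The word is anchored at its right end, with last letter [i], and grows by prepending: it serves
    as a suffix of reduced words. *)
Fixpoint alt_word (i j : 'I_n) (t : nat) : seq 'I_n :=
  if t is t'.+1 then (if odd t' then j else i) :: alt_word i j t' else [::].

Lemma size_alt_word i j t : size (alt_word i j t) = t.
Proof. by elim: t => //= t ->. Qed.

Lemma alt_word_rcons i j t : exists a, alt_word i j t.+1 = rcons a i.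
Proof.
elim: t => [|t [a eqa]]; first by exists [::].
by exists ((if odd t.+1 then j else i) :: a); rewrite rcons_cons -eqa.
Qed.

(** One alternating word times the inverse of the other is a power of [g i * g j] or of its inverse,
    with the common length as exponent. *)
Lemma braid i j : wp (alt_word i j (cox_mx C i j)) = wp (alt_word j i (cox_mx C i j)).
Proof.
have step t : wp (alt_word i j t) * (wp (alt_word j i t))^-1 =
    (if odd t then g i * g j else g j * g i) ^+ t.
  elim: t => [|t IHt]; first by rewrite /= word_prod_nil mulgV expg0.
  rewrite /= !word_prod_cons invgM -!mulgA (mulgA (wp _)) IHt genV expgS.
  case: (odd t) => /=; rewrite -!mulgA; congr (_ * _);
    elim: t {IHt} => [|t IHt]; rewrite ?expg0 ?mul1g ?mulg1 // !expgS.
  - by rewrite -!mulgA IHt.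
  - by rewrite -!mulgA IHt.
apply: (mulIg (wp (alt_word j i (cox_mx C i j)))^-1); rewrite mulgV step.
by case: ifP; rewrite ?gen_mul_order // (cox_mx_sym C) gen_mul_order.
Qed.

End Length.

(** * The geometric representation *)

Section LinearRecurrence.
Variables (R : comPzRingType) (x : R).

Fixpoint lin_rec (a b : R) (t : nat) : R :=
  if t is t'.+1 then lin_rec b (x * b - a) t' else a.

Lemma lin_recSS a b t : lin_rec a b t.+2 = x * lin_rec a b t.+1 - lin_rec a b t.
Proof. by elim: t a b => //= t IHt a b; rewrite -IHt. Qed.

Lemma lin_rec_uniq (f : nat -> R) :
  (forall t, f t.+2 = x * f t.+1 - f t) -> forall t, f t = lin_rec (f 0%N) (f 1%N) t.
Proof.
move=> fSS t; suff [] : f t = lin_rec (f 0%N) (f 1%N) t /\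
  f t.+1 = lin_rec (f 0%N) (f 1%N) t.+1 by [].
by elim: t => // t [IH0 IH1]; rewrite IH1 fSS lin_recSS IH0 IH1.
Qed.

End LinearRecurrence.

(* [chebyshev (2 * cos h) t = sin (t * h) / sin h] *)
Notation chebyshev x := (lin_rec x 0 1).

(** At [m] and [m.+1] the Chebyshev sequence takes the opposites of its initial values, and every
    solution of the recurrence is a combination of that sequence and its shift; so [m] steps change
    the sign. *)
Lemma lin_rec_period (R : comNzRingType) (x a b : R) m t :
  chebyshev x m = 0 -> chebyshev x m.+1 = -1 ->
  lin_rec x a b (t + m) = - lin_rec x a b t.
Proof.
move=> xm xm1.
have expand s : lin_rec x a b s.+1 = b * chebyshev x s.+1 - a * chebyshev x s.
  pose f s := b * chebyshev x s - a * (x * chebyshev x s - chebyshev x s.+1).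
  have fE r : f r.+1 = b * chebyshev x r.+1 - a * chebyshev x r.
    by rewrite /f lin_recSS; ring.
  have -> : lin_rec x a b s.+1 = f s.+1; last exact: fE.
  rewrite [RHS](@lin_rec_uniq _ x f) => [|r]; last by rewrite /f !lin_recSS; ring.
  by congr lin_rec; rewrite /f /=; ring.
pose h s := lin_rec x a b (s + m).
have hSS s : h s.+2 = x * h s.+1 - h s by rewrite /h !addSn lin_recSS.
pose k s := - lin_rec x a b s.
have kSS s : k s.+2 = x * k s.+1 - k s by rewrite /k lin_recSS; ring.
rewrite -/(h t) -/(k t) (lin_rec_uniq hSS) (lin_rec_uniq kSS).
congr lin_rec; rewrite /h /k /= ?add0n ?add1n.
  (* For [m = 0] the second hypothesis reads [1 = -1] in [R]. *)
  case: m xm xm1 {h k hSS kSS} => [|m] xm xm1.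
    by have := congr1 (fun y => a * y) xm1; rewrite /= mulr1 mulrN1.
  rewrite -[LHS]/(lin_rec x a b m.+1) expand.
    by move: xm1; rewrite lin_recSS xm => xm1; ring: xm1.
by rewrite -[LHS]/(lin_rec x a b m.+1) expand xm1 xm; ring.
Qed.

(* [kap i j] plays the role of [2 * cos (pi / cox_mx C i j)], with [2] for an
   infinite order; only these consequences matter. *)
Record cosine_matrix (W : groupType) (n : nat) (C : coxeter_system W n)
    (R : realFieldType) := CosineMatrix {
  kap :> 'I_n -> 'I_n -> R;
  kap_sym : forall i j, kap i j = kap j i;
  kap_pos : forall i j t, i != j -> (0 < t)%N ->
    (cox_mx C i j == 0)%N || (t < cox_mx C i j)%N -> 0 < chebyshev (kap i j) t;
  kap_finite : forall i j, i != j -> (cox_mx C i j != 0)%N ->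
    [/\ chebyshev (kap i j) (cox_mx C i j) = 0,
        chebyshev (kap i j) (cox_mx C i j).+1 = -1 & kap i j ^+ 2 != 4]
}.

Section Geometric.
Variables (R : realFieldType) (W : groupType) (n : nat) (C : coxeter_system W n).
Variable K : cosine_matrix C R.
Local Notation g := (cox_gen C).
Local Notation wp := (word_prod g).
Local Notation ell := (cox_length C).
Local Notation V := 'rV[R]_n.
Implicit Types (u v : V) (i j r s : 'I_n).

(** The entry is its own Chebyshev value at 2: positive if the order is infinite or above 2, zero if
    it is 2. *)
Lemma kap_ge0 i j : i != j -> 0 <= K i j.
Proof.
move=> neq; have u2 : chebyshev (K i j) 2 = K i j by rewrite /= mulr1 subr0.
rewrite -u2; have [m0|m_neq0] := eqVneq (cox_mx C i j) 0%N.
  by apply/ltW/kap_pos; rewrite ?m0.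
have [m2|m2] := ltnP 2 (cox_mx C i j); first by apply/ltW/kap_pos; rewrite ?m2 ?orbT.
suff <- : cox_mx C i j = 2%N by have [-> _ _] := kap_finite K neq m_neq0.
by have := cox_mx_offdiag C neq; lia.
Qed.

Definition sroot i : V := delta_mx 0 i.

Definition cartan i j : R := if i == j then 2 else - K i j.

(* twice the symmetric form, evaluated at the simple root [sroot i] and [v] *)
Definition bil i v : R := \sum_j cartan i j * v 0 j.

Definition refl i v : V := v - bil i v *: sroot i.

Lemma srootE i j : sroot i 0 j = (i == j)%:R.
Proof. by rewrite mxE eqxx eq_sym. Qed.

Lemma bilD i u v : bil i (u + v) = bil i u + bil i v.
Proof. by rewrite -big_split; apply: eq_bigr => j _; rewrite mxE mulrDr. Qed.

Lemma bilZ i a v : bil i (a *: v) = a * bil i v.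
Proof. by rewrite mulr_sumr; apply: eq_bigr => j _; rewrite mxE mulrCA. Qed.

Lemma bilN i v : bil i (- v) = - bil i v.
Proof. by rewrite -scaleN1r bilZ mulN1r. Qed.

Lemma bil_sroot i j : bil i (sroot j) = cartan i j.
Proof.
rewrite /bil (bigD1 j) //= srootE eqxx mulr1 big1 ?addr0 // => k kj.
by rewrite srootE eq_sym (negPf kj) mulr0.
Qed.

Lemma reflD i u v : refl i (u + v) = refl i u + refl i v.
Proof. by rewrite /refl bilD scalerDl opprD addrACA. Qed.

Lemma reflZ i a v : refl i (a *: v) = a *: refl i v.
Proof. by rewrite /refl bilZ scalerBr scalerA. Qed.

Lemma reflN i v : refl i (- v) = - refl i v.
Proof. by rewrite -scaleN1r reflZ scaleN1r. Qed.

Lemma refl_sroot i : refl i (sroot i) = - sroot i.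
Proof.
rewrite /refl bil_sroot /cartan eqxx -[X in X - _]scale1r -scalerBl.
by rewrite -scaleN1r; congr (_ *: _); ring.
Qed.

Lemma bil_refl_same i v : bil i (refl i v) = - bil i v.
Proof. by rewrite /refl bilD bilN bilZ bil_sroot /cartan eqxx; ring. Qed.

Lemma reflK i v : refl i (refl i v) = v.
Proof. by rewrite {1}/refl bil_refl_same scaleNr opprK /refl subrK. Qed.

Lemma refl_coord i v j : j != i -> refl i v 0 j = v 0 j.
Proof. by move=> ji; rewrite !mxE eqxx (negPf ji) mulr0 subr0. Qed.

Lemma refl_coord_same i v : refl i v 0 i = v 0 i - bil i v.
Proof. by rewrite !mxE !eqxx mulr1. Qed.

Lemma bil_refl i j v : i != j -> bil i (refl j v) = bil i v + K i j * bil j v.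
Proof.
by move=> ij; rewrite /refl bilD bilN bilZ bil_sroot /cartan (negPf ij); ring.
Qed.

(** Along the orbit, the pairings with the two simple roots are, up to sign, consecutive terms of a
    single linear recurrence, and the displacement sums its odd and even terms. *)
Lemma refl_pair_iter i j v t : i != j ->
  let c := lin_rec (K i j) (- bil i v) (bil j v) in
  let vt := iter t (refl i \o refl j) v in
  [/\ vt = v - (\sum_(k < t) c k.*2.+1) *: sroot j -
               (\sum_(k < t) c k.*2.+2) *: sroot i,
      bil i vt = - c t.*2 & bil j vt = c t.*2.+1].
Proof.
move=> ij; elim: t => [|t [IHv IHi IHj]].
  by rewrite /= !big_ord0 !scale0r !subr0 opprK.
set c := lin_rec _ _ _ in IHv IHi IHj *; rewrite /= -/c in IHv IHi IHj *.
set vt := iter t _ v in IHv IHi IHj *.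
have ji : j != i by rewrite eq_sym.
have bi : bil i (refl j vt) = c t.*2.+2.
  by rewrite bil_refl // IHi IHj [RHS]lin_recSS addrC.
split.
- rewrite {1}/refl bi /refl IHj {1}IHv !big_ord_recr /= !scalerDl !opprD.
  rewrite -!addrA; congr (_ + (_ + _)).
  by rewrite !addrA; congr (_ + _); rewrite addrC.
- by rewrite bil_refl_same bi doubleS.
- rewrite bil_refl // bi bil_refl_same IHj (kap_sym K).
  by rewrite doubleS [RHS]lin_recSS addrC.
Qed.

(** The recurrence has period twice the order, so its odd and even subsequences have period [m].
    Each satisfies the recurrence with parameter [x ^+ 2 - 2]; summing that over a period gives
    [x ^+ 2 - 4] times the sum equal to zero, so the displacement vanishes. *)
Lemma refl_pair_order i j v :
  iter (cox_mx C i j) (refl i \o refl j) v = v.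
Proof.
have [<-|ij] := eqVneq i j.
  by rewrite cox_mx_diag /= reflK.
have [->//|m0] := eqVneq (cox_mx C i j) 0%N.
have [um um1 k4] := kap_finite K ij m0; set m := cox_mx C i j in um um1 m0 *.
have [-> _ _] := refl_pair_iter v m ij.
set x := K i j in um um1 k4 *; set c := lin_rec _ _ _.
have cm t : c (t + m.*2)%N = c t.
  by rewrite -addnn addnA /c !lin_rec_period // opprK.
have shift (d : nat -> R) : (forall t, d (t + m)%N = d t) ->
    \sum_(k < m) d k.+1 = \sum_(k < m) d k.
  move=> dm; case: (m) m0 dm => // m' _ dm.
  by rewrite big_ord_recr big_ord_recl /= [RHS]addrC -(dm 0%N).
have sum0 (d : nat -> R) : (forall t, d (t + m)%N = d t) ->
    (forall t, d t.+2 = (x ^+ 2 - 2) * d t.+1 - d t) -> \sum_(k < m) d k = 0.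
  move=> dm dSS; have dm1 t : d (t + m).+1 = d t.+1 by rewrite -addSn dm.
  have := shift (d \o S) dm1; rewrite /= (shift d dm).
  under eq_bigr do rewrite dSS.
  rewrite sumrB -mulr_sumr (shift d dm) => e.
  have /eqP : (x ^+ 2 - 4) * (\sum_(k < m) d k) = 0.
    have -> : forall S : R, (x ^+ 2 - 4) * S = (x ^+ 2 - 2) * S - S - S by move=> S; ring.
    by rewrite e subrr.
  by rewrite mulf_eq0 subr_eq0 (negPf k4) => /eqP.
have cSS t : c t.+4 = (x ^+ 2 - 2) * c t.+2 - c t.
  by rewrite /c !lin_recSS; ring.
rewrite (sum0 (fun k => c k.*2.+1)) => [|t|t]; rewrite ?doubleD -?addSn ?cm ?cSS //.
by rewrite (sum0 (fun k => c k.*2.+2)) => [|t|t];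
  rewrite ?doubleD -?addSn ?cm ?cSS // !scale0r !subr0.
Qed.

Definition act (a : seq 'I_n) v : V := foldr refl v a.

Lemma act_cat a b v : act (a ++ b) v = act a (act b v).
Proof. by rewrite /act foldr_cat. Qed.

Lemma act_congr a b v : cox_congr (cox_mx C) a b -> act a v = act b v.
Proof.
move=> ab; elim: ab v => // {a b}.
- by move=> a b c _ IH1 _ IH2 v; rewrite IH1.
move=> a b i j v.
rewrite !act_cat; congr act; rewrite -[RHS](refl_pair_order i j).
by elim: (cox_mx C i j) => //= m ->.
Qed.

(** Every element has a word, and by [act_congr] all its words act alike, so any choice of word will
    do. *)
Definition rho (w : W) v : V := act (xget [::] [set a | wp a = w]%classic) v.

Lemma rho_word a v : rho (wp a) v = act a v.
Proof.
apply: act_congr; apply/(cox_presented C).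
by apply: (@xgetPex _ [::] [set b | wp b = wp a]%classic); exists a.
Qed.

Lemma rhoM w1 w2 v : rho (w1 * w2)%g v = rho w1 (rho w2 v).
Proof.
have [a1 <- _] := reduced_word C w1; have [a2 <- _] := reduced_word C w2.
by rewrite -word_prod_cat !rho_word act_cat.
Qed.

Lemma rho1 v : rho 1%g v = v.
Proof. by rewrite -(word_prod_nil C) rho_word. Qed.

Lemma rho_gen i v : rho (g i) v = refl i v.
Proof. by rewrite -[g i]mulg1 -(word_prod_nil C) -word_prod_cons rho_word. Qed.

Lemma rhoK w v : rho w^-1 (rho w v) = v.
Proof. by rewrite -rhoM mulVg rho1. Qed.

Lemma rhoVK w v : rho w (rho w^-1 v) = v.
Proof. by rewrite -rhoM mulgV rho1. Qed.

Lemma rhoD w u v : rho w (u + v) = rho w u + rho w v.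
Proof.
have [a <- _] := reduced_word C w; rewrite !rho_word.
by elim: a => //= i a ->; rewrite reflD.
Qed.

Lemma rhoZ w a v : rho w (a *: v) = a *: rho w v.
Proof.
have [b <- _] := reduced_word C w; rewrite !rho_word.
by elim: b => //= i b ->; rewrite reflZ.
Qed.

Lemma rhoN w v : rho w (- v) = - rho w v.
Proof. by rewrite -scaleN1r rhoZ scaleN1r. Qed.

Definition nonneg v : Prop := forall i, 0 <= v 0 i.

Lemma nonnegD u v : nonneg u -> nonneg v -> nonneg (u + v).
Proof. by move=> u0 v0 i; rewrite mxE addr_ge0. Qed.

Lemma nonnegZ a v : 0 <= a -> nonneg v -> nonneg (a *: v).
Proof. by move=> a0 v0 i; rewrite mxE mulr_ge0. Qed.

Lemma nonneg_sroot i : nonneg (sroot i).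
Proof. by move=> j; rewrite srootE; case: eqP. Qed.

(** The rank two case of [nonneg_rho]: the coefficients are Chebyshev values, positive as long as
    the index stays below the order. *)
Lemma act_alt_word i j t : i != j ->
  act (alt_word i j t) (sroot j) =
  chebyshev (K i j) t.+1 *: sroot (if odd t then i else j) +
  chebyshev (K i j) t *: sroot (if odd t then j else i).
Proof.
move=> ij; elim: t => [|t IHt]; first by rewrite /= scale1r scale0r addr0.
rewrite [LHS]/= IHt reflD !reflZ lin_recSS /=.
by case: (odd t); rewrite /= refl_sroot /refl bil_sroot /cartan
  ?(negPf ij) 1?eq_sym ?(negPf ij) ?(kap_sym K j i);
  apply/rowP => k; rewrite !mxE; ring.
Qed.

(** Split off the longest alternating suffix in [r] and [s] ending in a right descent [r] of [w].
    The remaining factor [v] sends both simple roots to nonnegative vectors by induction, and the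
    suffix sends [sroot s] to a nonnegative combination of the two. *)
Theorem nonneg_rho w i : ell (w * g i)%g = (ell w).+1 -> nonneg (rho w (sroot i)).
Proof.
have [N] := ubnP (ell w); elim: N w i => // N IHN w s lewN lews.
have [->|w1] := EM (w = 1%g); first by rewrite rho1; exact: nonneg_sroot.
have [r ler] := right_descent C w1.
have rs : r != s by apply/eqP => ers; rewrite ers lews in ler; lia.
pose P t := `[< exists2 v, w = (v * wp (alt_word r s t))%g & ell w = (ell v + t)%N >].
have P1 : P 1%N.
  by apply/asboolP; exists (w * g r)%g;
     rewrite ?addn1 // word_prod_cons word_prod_nil mulg1 mulgen_K.
have Pdown t : P t.+1 -> P t.
  move=> /asboolP[v wE lew]; apply/asboolP; set z := if odd t then s else r.
  exists (v * g z)%g; first by rewrite wE /= word_prod_cons mulgA.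
  have := lengthM C (v * g z)%g (wp (alt_word r s t)).
  rewrite -mulgA -word_prod_cons -[_ :: _]/(alt_word r s t.+1) -wE.
  have := length_word C (alt_word r s t); rewrite size_alt_word.
  by have [] := length_mul_gen C z v; lia.
have Pmono t1 t2 : (t1 <= t2)%N -> P t2 -> P t1.
  by move=> le12; rewrite -(subnK le12); elim: (t2 - t1)%N => // t IHt /Pdown.
have Ptop t : P t -> (t <= ell w)%N by move=> /asboolP[v _ ->]; rewrite leq_addl.
have [t Pt maxt] := ex_maxnP (ex_intro _ 1%N P1) Ptop.
(* A suffix as long as the braid relation could be rewritten to end in [s], making [s] a right
   descent of [w]. *)
have tm : (cox_mx C r s == 0)%N || (t < cox_mx C r s)%N.
  have [//|m0] := eqVneq (cox_mx C r s) 0%N; rewrite ltnNge; apply/negP => mt.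
  have /asboolP[v wE lew] := Pmono _ _ mt Pt.
  rewrite braid in wE; case: (cox_mx C r s) m0 wE lew => // m _ wE lew.
  have [a aE] := alt_word_rcons s r m.
  have sa : size a = m by have := size_alt_word s r m.+1; rewrite aE size_rcons; case.
  have := lengthM C v (wp a); have := length_word C a.
  suff -> : (v * wp a)%g = (w * g s)%g by lia.
  by rewrite wE aE word_prod_rcons mulgA mulgen_K.
have t1 := maxt _ P1; have /asboolP[v wE lew] := Pt.
(* If [z] shortened [v], it would either extend the maximal suffix or cancel its first letter and
   shorten [w]. *)
have vup z : z = r \/ z = s -> ell (v * g z)%g = (ell v).+1.
  have [//|vz] := length_mul_gen C z v; move=> zrs; exfalso.
  have [zE|zE] : z = (if odd t then s else r) \/ z = (if odd t then r else s).
  - by case: (odd t) zrs => -[]; auto.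
  - suff : P t.+1 by move=> /maxt; rewrite ltnn.
    apply/asboolP; exists (v * g z)%g; last by lia.
    by rewrite /= -zE word_prod_cons mulgA mulgen_K.
  - case: t t1 lew wE zE {Pt maxt tm} => // t _ lew wE zE.
    have := lengthM C (v * g z)%g (wp (alt_word r s t)).
    have := length_word C (alt_word r s t); rewrite size_alt_word.
    suff -> : (v * g z * wp (alt_word r s t))%g = w by lia.
    rewrite wE /= word_prod_cons; have -> : z = if odd t then s else r.
      by rewrite zE /=; case: (odd t).
    by rewrite mulgA.
have IH z : z = r \/ z = s -> nonneg (rho v (sroot z)).
  by move=> /vup; apply: IHN; lia.
rewrite wE rhoM rho_word act_alt_word // rhoD !rhoZ.
have u_ge0 : 0 <= chebyshev (K r s) t by apply/ltW/kap_pos.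
(* The index [t.+1] may reach the order itself, where the value is zero. *)
have u1_ge0 : 0 <= chebyshev (K r s) t.+1.
  have [m0|m0] := eqVneq (cox_mx C r s) 0%N; first by apply/ltW/kap_pos; rewrite ?m0.
  have [] := ltnP t.+1 (cox_mx C r s) => tm1.
    by apply/ltW/kap_pos; rewrite ?tm1 ?orbT.
  suff -> : t.+1 = cox_mx C r s by have [-> _ _] := kap_finite K rs m0.
  by move: tm; rewrite (negPf m0) /=; lia.
by apply: nonnegD; apply: nonnegZ => //; apply: IH; case: (odd t); auto.
Qed.

End Geometric.

(** * Roots and inversions *)

Section Roots.
Variables (R : realFieldType) (W : groupType) (n : nat) (C : coxeter_system W n).
Variable K : cosine_matrix C R.
Local Notation g := (cox_gen C).
Local Notation wp := (word_prod g).
Local Notation ell := (cox_length C).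
Local Notation V := 'rV[R]_n.
Local Notation sroot := (@sroot R n).
Local Notation rho := (rho K).
Local Notation refl := (refl K).
Local Notation bil := (bil K).
Implicit Types (u v : V) (i j r s : 'I_n) (w x y z : W) (J : {set 'I_n}).

Definition sform u v : R := \sum_i u 0 i * bil i v.

Lemma sformDl u1 u2 v : sform (u1 + u2) v = sform u1 v + sform u2 v.
Proof. by rewrite -big_split; apply: eq_bigr => i _; rewrite mxE mulrDl. Qed.

Lemma sformZl a u v : sform (a *: u) v = a * sform u v.
Proof. by rewrite mulr_sumr; apply: eq_bigr => i _; rewrite mxE mulrA. Qed.

Lemma sformC u v : sform u v = sform v u.
Proof.
rewrite /sform; under eq_bigr do rewrite mulr_sumr.
rewrite exchange_big; apply: eq_bigr => i _; rewrite mulr_sumr.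
apply: eq_bigr => j _; rewrite /cartan eq_sym (kap_sym K).
by ring.
Qed.

Lemma sform_sroot i v : sform (sroot i) v = bil i v.
Proof.
rewrite /sform (bigD1 i) //= srootE eqxx mul1r big1 ?addr0 // => j ji.
by rewrite srootE eq_sym (negPf ji) mul0r.
Qed.

Lemma sform_refl i u v : sform (refl i u) (refl i v) = sform u v.
Proof.
have expand a : refl i a = a + (- bil i a) *: sroot i by rewrite scaleNr.
rewrite {1}expand sformDl sformZl sform_sroot bil_refl_same sformC expand.
by rewrite sformDl sformZl sform_sroot sformC; ring.
Qed.

Lemma sform_rho w u v : sform (rho w u) (rho w v) = sform u v.
Proof.
have [a <- _] := reduced_word C w; rewrite !rho_word.
by elim: a => //= i a IHa; rewrite sform_refl.
Qed.

Definition cox_root v : Prop := exists w i, v = rho w (sroot i).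

Definition proot v : Prop := cox_root v /\ nonneg v.

(** Left inversions: the reflection in [v] shortens [w] when multiplied on the left. Containment of
    these sets is the right weak order. *)
Definition inv w v : Prop := proot v /\ nonneg (- rho w^-1%g v).

Lemma root_sroot i : cox_root (sroot i).
Proof. by exists 1%g, i; rewrite rho1. Qed.

Lemma proot_sroot i : proot (sroot i).
Proof. by split; [exact: root_sroot | exact: nonneg_sroot]. Qed.

Lemma root_rho w v : cox_root v -> cox_root (rho w v).
Proof. by move=> [x [i ->]]; exists (w * x)%g, i; rewrite rhoM. Qed.

Lemma root_refl i v : cox_root v -> cox_root (refl i v).
Proof. by rewrite -rho_gen; exact: root_rho. Qed.

Lemma rootN v : cox_root v -> cox_root (- v).
Proof.
move=> [x [i ->]]; exists (x * g i)%g, i.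
by rewrite rhoM rho_gen refl_sroot rhoN.
Qed.

Lemma sform_root v : cox_root v -> sform v v = 2.
Proof.
by move=> [x [i ->]]; rewrite sform_rho sform_sroot bil_sroot /cartan eqxx.
Qed.

Lemma root_neq0 v : cox_root v -> v != 0.
Proof.
move=> rv; apply/eqP => v0; have := sform_root rv.
rewrite v0 -(scale0r 0) sformZl mul0r => /esym/eqP.
by rewrite pnatr_eq0.
Qed.

Lemma root_nonneg v : cox_root v -> nonneg v \/ nonneg (- v).
Proof.
move=> [w [i ->]]; have [lew|lew] := length_mul_gen C i w.
  by left; exact: nonneg_rho.
right; have -> : - rho w (sroot i) = rho (w * g i)%g (sroot i).
  by rewrite rhoM rho_gen refl_sroot rhoN.
by apply: nonneg_rho; rewrite mulgen_K.
Qed.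

Lemma nonneg_anti v : nonneg v -> nonneg (- v) -> v = 0.
Proof.
move=> v0 nv0; apply/rowP => i; apply/le_anti; rewrite mxE v0 andbT.
by have := nv0 i; rewrite mxE oppr_ge0.
Qed.

Lemma root_nonneg_anti v : cox_root v -> nonneg v -> ~ nonneg (- v).
Proof. by move=> /root_neq0/eqP v0 pv nv; exact/v0/nonneg_anti. Qed.

Lemma proot_scale_sroot i c : proot (c *: sroot i) -> c = 1.
Proof.
move=> [rv pv]; have := sform_root rv.
rewrite sformZl sform_sroot bilZ bil_sroot /cartan eqxx => c2.
have := pv i; rewrite mxE srootE eqxx mulr1 => c0.
have /eqP : (c - 1) * (c + 1) = 0 by lra.
by rewrite mulf_eq0 subr_eq0 => /orP[/eqP//|/eqP]; lra.
Qed.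

Lemma proot_only_sroot i v : proot v -> (forall j, j != i -> v 0 j = 0) -> v = sroot i.
Proof.
move=> pv v0; have vE : v = v 0 i *: sroot i.
  apply/rowP => j; rewrite mxE srootE eq_sym; have [->|ji] := eqVneq j i.
    by rewrite mulr1.
  by rewrite mulr0 v0.
by rewrite vE in pv *; rewrite (proot_scale_sroot pv) scale1r.
Qed.

(** The reflection changes only coordinate [i], so a positive root with another nonzero coordinate
    cannot become negative. *)
Lemma proot_refl i v : proot v -> v <> sroot i -> proot (refl i v).
Proof.
move=> pv vi; have rv := root_refl i pv.1; split=> //.
have [//|neg] := root_nonneg rv; exfalso; apply/vi/proot_only_sroot => // j ji.
apply/le_anti; rewrite pv.2 andbT.
by have := neg j; rewrite mxE oppr_ge0 refl_coord.
Qed.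

Lemma sroot_not_refl i v : nonneg v -> refl i v <> sroot i.
Proof.
move=> pv e; have := congr1 (refl i) e; rewrite reflK refl_sroot => e2.
by have := pv i; rewrite e2 mxE srootE eqxx oppr_ge0 ler10.
Qed.

Lemma invP w v : proot v -> ~ inv w v -> nonneg (rho w^-1%g v).
Proof.
move=> pv niv; have [//|h] := root_nonneg (root_rho w^-1%g pv.1).
by case: niv.
Qed.

Lemma inv_not_nonneg w v : inv w v -> ~ nonneg (rho w^-1%g v).
Proof. by move=> [[rv _] h] h2; exact: (root_nonneg_anti (root_rho _ rv) h2). Qed.

Lemma inv1 v : ~ inv 1%g v.
Proof. by move=> [[rv pv]]; rewrite invg1 rho1; exact: root_nonneg_anti. Qed.

Definition desc s w : Prop := inv w (sroot s).

Lemma descP s w : desc s w <-> ell w = (ell (g s * w)%g).+1.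
Proof.
have pos x : ell (g s * x)%g = (ell x).+1 -> nonneg (rho x^-1%g (sroot s)).
  by move=> lx; apply: nonneg_rho; rewrite -[X in (_ * X)%g]genV -invgM !lengthV.
have [lw|lw] := length_gen_mul C s w; split; try lia.
  by move=> /inv_not_nonneg; case; exact: pos.
move=> _; split; first exact: proot_sroot.
have -> : - rho w^-1%g (sroot s) = rho (g s * w)^-1%g (sroot s).
  by rewrite invgM genV rhoM rho_gen refl_sroot rhoN.
by apply: pos; rewrite gen_mulKg.
Qed.

Lemma length_desc s w : desc s w -> ell w = (ell (g s * w)%g).+1.
Proof. by move/descP. Qed.

Lemma desc_mul s w : desc s w -> ~ desc s (g s * w)%g.
Proof. by move=> /descP + /descP; rewrite gen_mulKg; lia. Qed.

Lemma ndesc_mul s w : ~ desc s w -> desc s (g s * w)%g.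
Proof.
by move=> /descP; rewrite descP gen_mulKg; have := length_gen_mul C s w; lia.
Qed.

(** Holds because [refl s] permutes the positive roots other than [sroot s]. It drives every
    induction that strips a left descent. *)
Lemma inv_desc s w v : desc s w ->
  inv w v <-> v = sroot s \/ inv (g s * w)%g (refl s v).
Proof.
move=> ds; have rhoE : rho (g s * w)^-1%g (refl s v) = rho w^-1%g v.
  by rewrite invgM genV rhoM rho_gen reflK.
split=> [iv|[->//|iv]].
  have [->|vs] := EM (v = sroot s); [by left|right]; split; last by rewrite rhoE; case: iv.
  exact: proot_refl iv.1 vs.
split; last by case: iv => _; rewrite rhoE.
rewrite -[v](reflK K s); apply: proot_refl iv.1 _ => e.
by apply: (desc_mul ds); rewrite /desc -e.
Qed.

Lemma inv_desc_refl s w v : desc s w -> inv w v -> v <> sroot s ->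
  inv (g s * w)%g (refl s v).
Proof. by move=> ds /(inv_desc _ ds)[]. Qed.

Lemma inv_refl_desc s w v : desc s w -> inv (g s * w)%g v -> inv w (refl s v).
Proof. by move=> ds iv; apply/(inv_desc _ ds); right; rewrite reflK. Qed.

Lemma inv_conv w u v a c : proot (a *: u + c *: v) -> 0 <= a -> 0 <= c ->
  inv w u -> inv w v -> inv w (a *: u + c *: v).
Proof.
move=> p a0 c0 [_ iu] [_ iv]; split=> //.
by rewrite rhoD !rhoZ opprD -!scalerN; apply: nonnegD; exact: nonnegZ.
Qed.

Lemma exists_desc w : w <> 1%g -> exists s, desc s w.
Proof. by move=> /(left_descent C)[s] /descP ds; exists s. Qed.

(** * The weak order as containment of inversion sets *)

Definition wle x y : Prop := forall v, inv x v -> inv y v.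

Lemma wle_refl x : wle x x. Proof. by []. Qed.

Lemma wle_trans y x z : wle x y -> wle y z -> wle x z.
Proof. by move=> xy yz v /xy/yz. Qed.

Lemma wle1 x : wle 1%g x. Proof. by move=> v /inv1. Qed.

Lemma wle_desc s x y : wle x y -> desc s x -> desc s y.
Proof. by move=> xy; exact: xy. Qed.

Lemma wle_strip s x y : desc s x -> desc s y ->
  wle (g s * x)%g (g s * y)%g <-> wle x y.
Proof.
move=> dx dy; split=> le_xy v.
  by move=> /(inv_desc _ dx)[->//|/le_xy iv]; apply/(inv_desc _ dy); right.
move=> iv; have := inv_refl_desc dx iv; move/le_xy => iv2.
rewrite -[v](reflK K s); apply: inv_desc_refl => //.
exact: sroot_not_refl iv.1.2.
Qed.

(** Stripping a common left descent preserves both conditions. A descent of [x] is one of [y] under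
    either: by containment, or because additivity of lengths makes [g s * y] shorter than [y]. *)
Lemma wle_weak_le x y : wle x y <-> weak_le C x y.
Proof.
rewrite /weak_le; have [N] := ubnP (ell x); elim: N x y => // N IHN x y ltN.
have [->|x1] := EM (x = 1%g).
  by rewrite length1 invg1 mul1g add0n eqxx; split=> // _; exact: wle1.
have [s dx] := exists_desc x1; have lx := length_desc dx.
have mulE : ((g s * x)^-1 * (g s * y) = x^-1 * y)%g.
  by rewrite invgM genV -mulgA gen_mulKg.
have lt1 : (ell (g s * x)%g < N)%N by lia.
have IH := IHN (g s * x)%g (g s * y)%g lt1; rewrite mulE in IH.
have key : desc s y -> wle x y <-> ell y == (ell x + ell (x^-1 * y)%g)%N.
  move=> dy; rewrite -(wle_strip dx dy) IH.
  by rewrite lx (length_desc dy) addSn eqSS.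
split=> [xy|e]; first by apply/key=> //; exact: wle_desc dx.
apply/key=> //; apply/descP.
have le2 : (ell (g s * y)%g <= ell (g s * x)%g + ell (x^-1 * y)%g)%N.
  by have := lengthM C (g s * x)%g (x^-1 * y)%g; rewrite mulgA mulgK.
by have := length_gen_mul C s y; move/eqP: e; lia.
Qed.

Lemma wle_length x y : wle x y -> (ell x <= ell y)%N.
Proof. by move=> /wle_weak_le/eqP ->; rewrite leq_addr. Qed.

Lemma wle_anti_length x y : wle x y -> (ell y <= ell x)%N -> x = y.
Proof.
move=> /wle_weak_le/eqP -> h.
have /(@length_eq0 _ _ C) e : ell (x^-1 * y)%g = 0%N by lia.
by rewrite -[LHS]mulg1 -e mulVKg.
Qed.

Lemma wle_anti x y : wle x y -> wle y x -> x = y.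
Proof. by move=> xy yx; apply: wle_anti_length => //; exact: wle_length. Qed.

Lemma wle_neq_length x y : wle x y -> x <> y -> (ell x < ell y)%N.
Proof. by move=> xy ne; rewrite ltnNge; apply/negP => /(wle_anti_length xy). Qed.

(** Here [x * g s] covers [x] in the weak order and is still below [y]; the vector is the root that
    this cover adds. *)
Lemma inv_left_factor x y s : wle x y -> desc s (x^-1 * y)%g -> inv y (rho x (sroot s)).
Proof.
move=> /wle_weak_le/eqP lxy ds; split; last first.
  by case: ds => _; rewrite invgM invgK rhoM.
split; first exact/root_rho/root_sroot.
apply: nonneg_rho; have := lengthM C (x * g s)%g (g s * (x^-1 * y))%g.
rewrite mulgA mulgen_K mulVKg; have := length_desc ds.
by have := length_mul_gen C s x; lia.
Qed.

(** The inverses of [y] and [y * g r] differ by [refl r], which changes the sign of no root except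
    [sroot r] and its opposite. *)
Lemma inv_mul_gen y r : ell y = (ell (y * g r)%g).+1 ->
  inv y (- rho y (sroot r)) /\
  forall v, inv (y * g r)%g v <-> inv y v /\ v <> - rho y (sroot r).
Proof.
move=> lyr; have pyr : proot (- rho y (sroot r)).
  split; first exact/rootN/root_rho/root_sroot.
  suff -> : - rho y (sroot r) = rho (y * g r)%g (sroot r).
    by apply: nonneg_rho; rewrite mulgen_K.
  by rewrite rhoM rho_gen refl_sroot rhoN.
have rhoE v : rho (y * g r)^-1%g v = refl r (rho y^-1%g v).
  by rewrite invgM genV rhoM rho_gen.
split=> [|v]; first by split=> //; rewrite rhoN rhoK opprK; exact: nonneg_sroot.
have nonsimple : nonneg v -> - rho y^-1%g v = sroot r <-> v = - rho y (sroot r).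
  by move=> pv; split=> [<-|->]; rewrite ?rhoN ?rhoVK ?rhoK ?opprK.
split=> [[pv]|[[pv nv] ne]].
  rewrite rhoE => h; have vne : v <> - rho y (sroot r).
    move=> e; move: h; rewrite e rhoN rhoK reflN opprK refl_sroot => h.
    by have := h r; rewrite mxE srootE eqxx oppr_ge0 ler10.
  split=> //; split=> //.
  have pr : proot (- refl r (rho y^-1%g v)).
    by split=> //; exact/rootN/root_refl/root_rho/pv.1.
  have [e|ne] := EM (- refl r (rho y^-1%g v) = sroot r).
    suff e2 : rho y^-1%g v = sroot r.
      case: (@inv_not_nonneg y v); rewrite ?e2; last exact: nonneg_sroot.
      by have := pyr.2; have := pv.2; rewrite -[v](rhoVK K y) e2; move=> h1 h2;
        case: (root_nonneg_anti (root_rho y (root_sroot r)) h1).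
    by rewrite -[LHS](reflK K r) -[X in refl r X]opprK e reflN refl_sroot opprK.
  by have := (proot_refl pr ne).2; rewrite reflN reflK.
have pr : proot (- rho y^-1%g v) by split=> //; exact/rootN/root_rho/pv.1.
split=> //; rewrite rhoE -reflN; apply: (proot_refl pr _).2.
by move/(nonsimple pv.2).
Qed.

(** Any right descent of [x^-1 * y] can be removed from [y] while staying above [x]. *)
Lemma lower_cover x y : wle x y -> x <> y ->
  exists r, [/\ wle x (y * g r)%g, inv y (- rho y (sroot r)) &
    forall v, inv (y * g r)%g v <-> inv y v /\ v <> - rho y (sroot r)].
Proof.
move=> xy ne; pose u := (x^-1 * y)%g.
have lxy : ell y = (ell x + ell u)%N by move: xy => /wle_weak_le/eqP.
have [|r lr0] := right_descent C (w := u).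
  by move=> e; apply: ne; rewrite -[LHS]mulg1 -e mulVKg.
have lr : ell u = (ell (u * g r)%g).+1 := lr0.
have le2 : (ell (y * g r)%g <= ell x + ell (u * g r)%g)%N.
  by have := lengthM C x (u * g r)%g; rewrite !mulgA mulgV mul1g.
have lyr : ell y = (ell (y * g r)%g).+1 /\
    ell (y * g r)%g = (ell x + ell (u * g r)%g)%N.
  by have := length_mul_gen C r y; lia.
have [iy eqv] := inv_mul_gen lyr.1.
by exists r; split=> //; apply/wle_weak_le/eqP; rewrite mulgA; case: lyr.
Qed.

(* The hypothesis says that [sroot s] is the root of the lower cover [y * g r] of
   [y]. *)
Lemma inv_refl_stable y r s v : rho y (sroot r) = - sroot s ->
  inv y v -> v <> sroot s -> inv y (refl s v).
Proof.
move=> yr iv vs; split; first exact: proot_refl iv.1 vs.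
have rhoE : rho y^-1%g (sroot s) = - sroot r.
  by rewrite -[sroot s]opprK -yr rhoN rhoK.
(* Since [y^-1] sends [sroot s] to [- sroot r], it conjugates one reflection into the other. *)
have -> : rho y^-1%g (refl s v) = refl r (rho y^-1%g v).
  rewrite /refl -!scaleNr rhoD rhoZ rhoE scalerN -scaleNr opprK.
  congr (_ + _ *: _); rewrite -!sform_sroot -(sform_rho y (sroot r)) yr rhoVK.
  by rewrite -scaleN1r sformZl mulN1r opprK.
have pr : proot (- rho y^-1%g v) by split; [exact/rootN/root_rho/iv.1.1|case: iv].
rewrite -reflN; apply: (proot_refl pr _).2 => e; apply: vs.
by rewrite -[v](rhoVK K y) -[rho _ v]opprK e rhoN yr opprK.
Qed.

Definition on (J : {set 'I_n}) v : Prop := forall i, i \notin J -> v 0 i = 0.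

Lemma on_refl J s v : s \in J -> on J (refl s v) <-> on J v.
Proof.
by move=> sJ; split=> h i iJ; have := h i iJ; rewrite refl_coord //;
  apply: contraNneq iJ => ->.
Qed.

Lemma on_sroot J s : on J (sroot s) <-> s \in J.
Proof.
split=> [h|sJ i iJ]; last by rewrite srootE (negPf (memPn iJ s sJ)).
by apply/negPn/negP => /h; rewrite srootE eqxx => /eqP; rewrite oner_eq0.
Qed.

(** An inversion supported on [J] is a nonnegative combination of simple roots that [w^-1] all sends
    to nonnegative vectors. *)
Lemma on_no_desc J w v : (forall s, s \in J -> ~ desc s w) -> on J v -> ~ inv w v.
Proof.
move=> nd vJ iv; apply: (inv_not_nonneg iv).
have -> : v = \sum_i v 0 i *: sroot i by exact: row_sum_delta.
elim/big_ind: _ => [|v1 v2|i _].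
- by rewrite -(scale0r 0) rhoZ scale0r => i; rewrite mxE.
- by rewrite rhoD; exact: nonnegD.
rewrite rhoZ; have [iJ|iJ] := boolP (i \in J).
  by apply: nonnegZ; [exact: iv.1.2|exact: invP (proot_sroot i) (nd i iJ)].
by rewrite vJ // scale0r => j; rewrite mxE.
Qed.

(** This is the parabolic component of [w], built by stripping left descents in [J] until none is
    left. *)
Lemma exists_restrict J w : exists x, [/\ wle x w &
  forall v, inv x v <-> inv w v /\ on J v].
Proof.
suff [x xP] : exists x, forall v, inv x v <-> inv w v /\ on J v.
  by exists x; split=> // v /xP[].
have [N] := ubnP (ell w); elim: N w => // N IHN w ltN.
have [[s [sJ ds]]|nd] := EM (exists s, s \in J /\ desc s w); last first.
  exists 1%g => v; split=> [/inv1//|[iv vJ]]; exfalso.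
  by apply: on_no_desc vJ iv => s sJ ds; apply: nd; exists s.
have [|x xP] := IHN (g s * w)%g; first by rewrite (length_desc ds) in ltN.
have ndx : ~ desc s x by move=> /xP[/(desc_mul ds)].
have dsx := ndesc_mul ndx; exists (g s * x)%g => v.
rewrite (inv_desc _ dsx) gen_mulKg xP (inv_desc _ ds) on_refl //.
split=> [[->|[]]|[[->|]]]; auto; split; auto; exact/on_sroot.
Qed.

End Roots.

(** * Rotated orders and the Euler form *)

Section Orders.
Variable n' : nat.
Local Notation n := n'.+1.
Implicit Types (k : nat) (i j : 'I_n).

(** The letter of the half-infinite word at index [k] counted from 0, hence at position [k.+1]. *)
Definition letter k : 'I_n := Ordinal (ltn_pmod k (ltn0Sn n')).

(* position of [i] in the order [letter k, letter k.+1, ...] of the generators *)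
Definition rank k i : nat :=
  if (k %% n <= i)%N then (i - k %% n)%N else (i + n - k %% n)%N.

Lemma rank_letter k : rank k (letter k) = 0%N.
Proof. by rewrite /rank leqnn subnn. Qed.

Lemma rank_inj k : injective (rank k).
Proof.
move=> i j; have := ltn_pmod k (ltn0Sn n'); have := ltn_ord i; have := ltn_ord j.
rewrite /rank; set c := (k %% n)%N; move: c => c ltj lti ltc e; apply: val_inj.
by move: e => /=; do 2! [case: leqP => ?]; lia.
Qed.

Lemma letter_rank k i : letter (k + rank k i) = i.
Proof.
apply: val_inj; rewrite /= -modnDml /rank.
have := ltn_pmod k (ltn0Sn n'); have := ltn_ord i => lti ltc; case: leqP => ci.
  by rewrite subnKC // modn_small.
rewrite subnKC; last exact: leq_trans (ltnW ltc) (leq_addl _ _).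
by rewrite modnDr modn_small.
Qed.

Lemma rankS_letter k : rank k.+1 (letter k) = n'.
Proof.
rewrite /rank /= -addn1 -modnDml addn1; have := ltn_pmod k (ltn0Sn n').
set c := (k %% n)%N; move: c => c ltc; have [ltc1|gec1] := ltnP c.+1 n.
  by rewrite modn_small // ltnn; lia.
have -> : c.+1 = n by lia.
by rewrite modnn leq0n subn0; lia.
Qed.

Lemma rankS k i : i != letter k -> rank k i = (rank k.+1 i).+1.
Proof.
rewrite -val_eqE /rank /= -[k.+1]addn1 -modnDml addn1.
have := ltn_pmod k (ltn0Sn n'); have := ltn_ord i.
set c := (k %% n)%N; move: c => c lti ltc ne; have [ltc1|gec1] := ltnP c.+1 n.
  by rewrite modn_small //; do 2! [case: leqP => ?]; lia.
have -> : c.+1 = n by lia.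
by rewrite modnn leq0n subn0; case: leqP => ?; lia.
Qed.

Lemma rankS_lt_letter k i : ~~ (rank k.+1 (letter k) < rank k.+1 i)%N.
Proof.
have := ltn_pmod k.+1 (ltn0Sn n'); have := ltn_ord i => lti ltc.
rewrite rankS_letter -leqNgt /rank; set c := (k.+1 %% n)%N; move: c ltc => c ltc.
by case: (leqP c i) => ?; lia.
Qed.

End Orders.

(** * The Euler form, its skew part, and their behaviour under rotation *)

Section EulerForm.
Variables (R : realFieldType) (W : groupType) (n' : nat).
Local Notation n := n'.+1.
Variables (C : coxeter_system W n) (K : cosine_matrix C R).
Local Notation V := 'rV[R]_n.
Local Notation sroot := (@sroot R n).
Local Notation rho := (rho K).
Local Notation refl := (refl K).
Local Notation bil := (bil K).
Local Notation sform := (sform K).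
Local Notation proot := (proot K).
Implicit Types (u v : V) (i j : 'I_n) (k : nat).

Definition euler_coef k i j : R :=
  if i == j then 1 else if (rank k i < rank k j)%N then - K i j else 0.

Definition euler k u v : R := \sum_i \sum_j u 0 i * euler_coef k i j * v 0 j.

Lemma eulerDl k u1 u2 v : euler k (u1 + u2) v = euler k u1 v + euler k u2 v.
Proof.
rewrite -big_split; apply: eq_bigr => i _ /=; rewrite -big_split.
by apply: eq_bigr => j _ /=; rewrite mxE; ring.
Qed.

Lemma eulerDr k u v1 v2 : euler k u (v1 + v2) = euler k u v1 + euler k u v2.
Proof.
rewrite -big_split; apply: eq_bigr => i _ /=; rewrite -big_split.
by apply: eq_bigr => j _ /=; rewrite mxE; ring.
Qed.

Lemma eulerZl k a u v : euler k (a *: u) v = a * euler k u v.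
Proof.
rewrite mulr_sumr; apply: eq_bigr => i _ /=; rewrite mulr_sumr.
by apply: eq_bigr => j _ /=; rewrite mxE; ring.
Qed.

Lemma eulerZr k a u v : euler k u (a *: v) = a * euler k u v.
Proof.
rewrite mulr_sumr; apply: eq_bigr => i _ /=; rewrite mulr_sumr.
by apply: eq_bigr => j _ /=; rewrite mxE; ring.
Qed.

Lemma euler_coef_sym k i j : euler_coef k i j + euler_coef k j i = cartan K i j.
Proof.
rewrite /euler_coef /cartan; have [_|ij] := eqVneq i j; first by ring.
case: ltngtP => [_|_|/(@rank_inj _ k) e].
- by rewrite addr0.
- by rewrite add0r (kap_sym K).
- by rewrite e eqxx in ij.
Qed.

Lemma euler_sym k u v : euler k u v + euler k v u = sform u v.
Proof.
rewrite /sform /bil; under [RHS]eq_bigr do rewrite mulr_sumr.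
rewrite {2}/euler exchange_big /= -big_split; apply: eq_bigr => i _ /=.
rewrite -big_split; apply: eq_bigr => j _ /=.
by rewrite -(euler_coef_sym k); ring.
Qed.

(** No generator precedes the initial letter, so its column of coefficients is diagonal. *)
Lemma euler_letterr k v : euler k v (sroot (letter n' k)) = v 0 (letter n' k).
Proof.
set s := letter n' k; rewrite /euler (bigD1 s) //= [X in _ + X]big1 => [|i is_].
  rewrite addr0 (bigD1 s) //= big1 => [|j js].
    by rewrite srootE /euler_coef eqxx !mulr1 addr0.
  by rewrite srootE eq_sym (negPf js) mulr0.
apply: big1 => j _; rewrite srootE; have [<-|_] := eqVneq s j; last by rewrite mulr0.
by rewrite /euler_coef (negPf is_) rank_letter ltn0 mulr0 mul0r.
Qed.

Lemma euler_letterl k v :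
  euler k (sroot (letter n' k)) v = bil (letter n' k) v - v 0 (letter n' k).
Proof. by rewrite -sform_sroot -(euler_sym k) euler_letterr addrK. Qed.

(** Rotation makes the letter last, so its row of coefficients is diagonal. *)
Lemma eulerS_letterl k v : euler k.+1 (sroot (letter n' k)) v = v 0 (letter n' k).
Proof.
set s := letter n' k; rewrite /euler (bigD1 s) //= [X in _ + X]big1 => [|i is_].
  rewrite addr0 (bigD1 s) //= big1 => [|j js].
    by rewrite srootE /euler_coef eqxx !mul1r addr0.
  rewrite srootE eqxx mul1r /euler_coef eq_sym (negPf js).
  by rewrite (negPf (rankS_lt_letter k j)) mul0r.
by apply: big1 => j _; rewrite srootE eq_sym (negPf is_) !mul0r.
Qed.

Lemma eulerS_letterr k v :
  euler k.+1 v (sroot (letter n' k)) = bil (letter n' k) v - v 0 (letter n' k).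
Proof. by rewrite -sform_sroot sformC -(euler_sym k.+1) eulerS_letterl addrK. Qed.

Lemma eulerS k u v : u 0 (letter n' k) = 0 -> v 0 (letter n' k) = 0 ->
  euler k.+1 u v = euler k u v.
Proof.
set s := letter n' k => us vs; apply: eq_bigr => i _; apply: eq_bigr => j _.
have [->|is_] := eqVneq i s; first by rewrite us !mul0r.
have [->|js] := eqVneq j s; first by rewrite vs !mulr0.
by congr (_ * _ * _); rewrite /euler_coef (rankS is_) (rankS js) ltnS.
Qed.

(** Split off the [s] coordinate of both vectors: on the remainders the two orders agree, and the
    terms with [sroot s] are explicit because [s] is first in one order and last in the other. *)
Lemma euler_refl k u v :
  euler k.+1 (refl (letter n' k) u) (refl (letter n' k) v) = euler k u v.
Proof.
set s := letter n' k.
have split_s (x : V) : exists2 y : V, x = x 0 s *: sroot s + y & y 0 s = 0.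
  exists (x - x 0 s *: sroot s); first by rewrite addrC subrK.
  by rewrite !mxE !eqxx mulr1 subrr.
have [u' uE us] := split_s u; have [v' vE vs] := split_s v.
have bil_s x : bil s (x *: sroot s) = x * 2 by rewrite bilZ bil_sroot /cartan eqxx.
have -> : refl s u = u + (- bil s u) *: sroot s by rewrite scaleNr.
have -> : refl s v = v + (- bil s v) *: sroot s by rewrite scaleNr.
rewrite !eulerDl !eulerDr !eulerZl !eulerZr !eulerS_letterl eulerS_letterr -/s.
have -> : euler k.+1 u v = u 0 s * v 0 s + v 0 s * bil s u' + euler k u' v'.
  rewrite {1}uE {1}vE eulerDl !eulerDr !eulerZl !eulerZr !eulerS_letterl.
  by rewrite eulerS_letterr eulerS // -/s us vs srootE eqxx /=; ring.
have -> : euler k u v = u 0 s * (bil s v - v 0 s) + euler k u' v'.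
  rewrite {1}uE eulerDl eulerZl euler_letterl -/s [X in euler k u' X]vE eulerDr eulerZr.
  by rewrite euler_letterr -/s us; ring.
have -> : bil s u = u 0 s * 2 + bil s u' by rewrite {1}uE bilD bil_s.
by rewrite srootE eqxx /=; ring.
Qed.

(** The sign is chosen so that the initial letter pairs nonnegatively, on the left, with every
    nonnegative vector. *)
Definition omega k u v : R := euler k v u - euler k u v.

Lemma omegaDl k u1 u2 v : omega k (u1 + u2) v = omega k u1 v + omega k u2 v.
Proof. by rewrite /omega eulerDl eulerDr; ring. Qed.

Lemma omegaZl k a u v : omega k (a *: u) v = a * omega k u v.
Proof. by rewrite /omega eulerZl eulerZr; ring. Qed.

Lemma omega_refl k u v :
  omega k.+1 (refl (letter n' k) u) (refl (letter n' k) v) = omega k u v.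
Proof. by rewrite /omega !euler_refl. Qed.

Lemma omegaS k u v : u 0 (letter n' k) = 0 -> v 0 (letter n' k) = 0 ->
  omega k.+1 u v = omega k u v.
Proof. by move=> us vs; rewrite /omega !eulerS. Qed.

Lemma omega_letter k v :
  omega k (sroot (letter n' k)) v = v 0 (letter n' k) *+ 2 - bil (letter n' k) v.
Proof. by rewrite /omega euler_letterr euler_letterl; ring. Qed.

Lemma omegaS_letter k v :
  omega k.+1 (sroot (letter n' k)) v = - omega k (sroot (letter n' k)) v.
Proof. by rewrite omega_letter /omega eulerS_letterr eulerS_letterl; ring. Qed.

Lemma omegaC k u v : omega k u v = - omega k v u.
Proof. by rewrite /omega; ring. Qed.

Lemma omega_letter_ge0 k v : nonneg v -> 0 <= omega k (sroot (letter n' k)) v.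
Proof.
set s := letter n' k => pv; rewrite omega_letter -/s /bil (bigD1 s) //=.
rewrite /cartan eqxx opprD addrA mulr_natl subrr sub0r -sumrN.
apply: sumr_ge0 => j js; rewrite eq_sym (negPf js) mulNr opprK mulr_ge0 //.
by rewrite kap_ge0 // eq_sym.
Qed.

(** Vanishing means that [bil] is twice the [s] coordinate, so reflection negates this coordinate;
    as [v] and its reflection are both positive roots, it is zero. *)
Lemma omega_letter_eq0 k v : proot v -> v <> sroot (letter n' k) ->
  omega k (sroot (letter n' k)) v = 0 -> bil (letter n' k) v = 0.
Proof.
set s := letter n' k => pv vs; rewrite omega_letter -/s => /eqP; rewrite subr_eq0 => /eqP e.
have := (proot_refl pv vs).2 s; rewrite refl_coord_same -e mulr2n => h.
have := pv.2 s; lra.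
Qed.

End EulerForm.

(** * Aligned elements *)

Section Aligned.
Variables (R : realFieldType) (W : groupType) (n' : nat).
Local Notation n := n'.+1.
Variables (C : coxeter_system W n) (K : cosine_matrix C R).
Local Notation g := (cox_gen C).
Local Notation wp := (word_prod g).
Local Notation ell := (cox_length C).
Local Notation V := 'rV[R]_n.
Local Notation sroot := (@sroot R n).
Local Notation rho := (rho K).
Local Notation refl := (refl K).
Local Notation bil := (bil K).
Local Notation sform := (sform K).
Local Notation proot := (proot K).
Local Notation inv := (inv K).
Local Notation desc := (desc K).
Local Notation wle := (wle K).
Local Notation act := (act K).
Local Notation omega := (omega K).
Local Notation letter := (letter n').
Implicit Types (u v : V) (i j r s : 'I_n) (w x y z : W) (k : nat).

(** Induction along the half-infinite word. Taking a letter shortens [w]; the number of letters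
    before some fixed descent [i] bounds the skips in between. *)
Lemma sorting_ind (P : nat -> W -> Prop) :
  (forall k, P k 1%g) ->
  (forall k w, desc (letter k) w -> P k.+1 (g (letter k) * w)%g -> P k w) ->
  (forall k w, ~ desc (letter k) w -> P k.+1 w -> P k w) ->
  forall k w, P k w.
Proof.
move=> P1 Ptake Pskip k w; have [N] := ubnP (ell w); elim: N k w => // N IHN k w ltN.
have [->//|w1] := EM (w = 1%g); have [i di] := exists_desc K w1.
have := letter_rank k i; move: (rank k i) => d; elim: d k => [|d IHd] k.
  rewrite addn0 => ei; rewrite -ei in di; apply: Ptake => //.
  by apply: IHN; rewrite (length_desc di) in ltN.
rewrite addnS -addSn => /IHd Pk1; have [dk|ndk] := EM (desc (letter k) w).
  by apply: Ptake => //; apply: IHN; rewrite (length_desc dk) in ltN.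
exact: Pskip.
Qed.

(* [w] lies in the standard parabolic subgroup without the generator [s]. *)
Definition avoids s w : Prop := forall v, inv w v -> v 0 s = 0.

Lemma on_setC1 s v : on [set~ s] v <-> v 0 s = 0.
Proof.
split=> [->//|vs i]; first by rewrite !inE eqxx.
by rewrite !inE negbK => /eqP->.
Qed.

Lemma avoids_ndesc s w : avoids s w -> ~ desc s w.
Proof. by move=> av /av/eqP; rewrite srootE eqxx oner_eq0. Qed.

Lemma avoids1 s : avoids s 1%g. Proof. by move=> v /inv1. Qed.

Lemma avoids_le s x y : wle x y -> avoids s y -> avoids s x.
Proof. by move=> xy ay v /xy/ay. Qed.

Lemma avoids_mul s i w : i != s -> desc i w -> avoids s w <-> avoids s (g i * w)%g.
Proof.
rewrite eq_sym => is_ di; split=> aw v.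
  by move=> /(inv_refl_desc di)/aw; rewrite refl_coord.
by move=> /(inv_desc _ di)[->|/aw]; rewrite ?refl_coord // srootE eq_sym (negPf is_).
Qed.

Lemma exists_parabolic_part s w : exists x, [/\ wle x w, avoids s x &
  forall v, inv x v <-> inv w v /\ v 0 s = 0].
Proof.
have [x [xw xP]] := exists_restrict K [set~ s] w; exists x; split=> // v.
  by move=> /xP[_ /on_setC1].
by rewrite xP on_setC1.
Qed.

Definition aligned k w : Prop := forall v1 v2 a c,
  proot v1 -> proot v2 -> 0 < a -> 0 < c ->
  inv w (a *: v1 + c *: v2) -> 0 < omega k v1 v2 -> inv w v1.

Lemma coord_sum_eq0 s v1 v2 a c : nonneg v1 -> nonneg v2 -> 0 < a -> 0 < c ->
  (a *: v1 + c *: v2) 0 s = 0 -> v1 0 s = 0 /\ v2 0 s = 0.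
Proof.
move=> p1 p2 a0 c0; rewrite !mxE => h; have := p1 s; have := p2 s => h1 h2.
have h3 : 0 <= c * v2 0 s by rewrite mulr_ge0 // ltW.
have h4 : 0 <= a * v1 0 s by rewrite mulr_ge0 // ltW.
have /eqP : a * v1 0 s = 0 by lra.
have /eqP : c * v2 0 s = 0 by lra.
by rewrite !mulf_eq0 (gt_eqF a0) (gt_eqF c0) /= => /eqP-> /eqP->.
Qed.

(** A simple root spans an extreme ray of the cone of nonnegative vectors. *)
Lemma proot_sum_sroot s v1 v2 a c : proot v1 -> proot v2 -> 0 < a -> 0 < c ->
  a *: v1 + c *: v2 = sroot s -> v1 = sroot s /\ v2 = sroot s.
Proof.
move=> p1 p2 a0 c0 e.
have coord0 j : j != s -> v1 0 j = 0 /\ v2 0 j = 0.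
  move=> js; apply: coord_sum_eq0 p1.2 p2.2 a0 c0 _.
  by rewrite e srootE eq_sym (negPf js).
by split; [apply: (proot_only_sroot p1) | apply: (proot_only_sroot p2)] => j /coord0[].
Qed.

Lemma aligned1 k : aligned k 1%g.
Proof. by move=> v1 v2 a c _ _ _ _ /inv1. Qed.

(** The reflection [refl s] matches the inversions other than [sroot s] on both sides and carries
    [omega k] to [omega k.+1]. The sign of [omega] excludes [v1 = sroot s] in the rotated order and
    [v2 = sroot s] in the original one. *)
Lemma aligned_take k w : desc (letter k) w ->
  aligned k w <-> aligned k.+1 (g (letter k) * w)%g.
Proof.
set s := letter k => ds; split=> al v1 v2 a c p1 p2 a0 c0 iv om.
  have v1s : v1 <> sroot s.
    move=> e; move: om; rewrite e omegaS_letter oppr_gt0 ltNge.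
    by rewrite omega_letter_ge0 //; exact: p2.2.
  have iwv := inv_refl_desc ds iv; rewrite reflD !reflZ in iwv.
  have ps1 := proot_refl p1 v1s.
  suff : inv w (refl s v1).
    move=> h; rewrite -[v1](reflK K s); apply: inv_desc_refl h _ => //.
    exact: sroot_not_refl p1.2.
  have [e2|v2s] := EM (v2 = sroot s); last first.
    apply: al iwv _ => //; first exact: proot_refl.
    by rewrite -(omega_refl K) !reflK.
  (* When [v2 = sroot s], the reflected sum has a negative [sroot s] term; adding that inversion
     back recovers [refl s v1] as a positive combination of inversions. *)
  have -> : refl s v1 = a^-1 *: (a *: refl s v1 + c *: refl s v2) + (a^-1 * c) *: sroot s.
    rewrite e2 refl_sroot scalerDr !scalerA mulVf ?gt_eqF // scale1r scalerN.
    by rewrite subrK.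
  have ai : 0 < a^-1 by rewrite invr_gt0.
  apply: inv_conv => //; rewrite ?ltW ?mulr_gt0 //.
  rewrite e2 refl_sroot scalerDr !scalerA mulVf ?gt_eqF // scale1r scalerN.
  by rewrite subrK.
have [->//|v1s] := EM (v1 = sroot s).
have v2s : v2 <> sroot s.
  move=> e; move: om; rewrite e omegaC oppr_gt0 ltNge.
  by rewrite omega_letter_ge0 //; exact: p1.2.
have sumN : a *: v1 + c *: v2 <> sroot s.
  by move=> e; apply: v1s; case: (proot_sum_sroot p1 p2 a0 c0 e).
have := inv_desc_refl ds iv sumN; rewrite reflD !reflZ => ivs.
apply/(inv_desc _ ds); right; apply: al ivs _ => //; try exact: proot_refl.
by rewrite omega_refl.
Qed.

(** Rotation changes only comparisons with [letter k], and the summands of an inversion without that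
    coordinate have none either. *)
Lemma aligned_avoids k w : avoids (letter k) w -> aligned k w <-> aligned k.+1 w.
Proof.
move=> aw; split=> al v1 v2 a c p1 p2 a0 c0 iv om; apply: (al v1 v2 a c) => //;
  have [h1 h2] := coord_sum_eq0 p1.2 p2.2 a0 c0 (aw _ iv).
- by rewrite -omegaS.
- by rewrite omegaS.
Qed.

Lemma aligned_restrict k J w x : aligned k w ->
  (forall v, inv x v <-> inv w v /\ on J v) -> aligned k x.
Proof.
move=> al xP v1 v2 a c p1 p2 a0 c0 /xP[iv vJ] om; apply/xP; split.
  exact: al iv om.
by move=> i /vJ; move/(coord_sum_eq0 p1.2 p2.2 a0 c0) => [].
Qed.

(** For a reduced word, these are the inversions of its product, in the order in which its prefixes
    acquire them. *)
Fixpoint inv_seq (a : seq 'I_n) : seq V :=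
  if a is i :: a' then sroot i :: map (refl i) (inv_seq a') else [::].

Lemma inv_seq_rcons a i : inv_seq (rcons a i) = rcons (inv_seq a) (act a (sroot i)).
Proof. by elim: a => //= j a ->; rewrite map_rcons. Qed.

(** The second clause turns a nonzero value of [sform] into a strict sign of [omega], as
    [aligned_descend] requires. *)
Definition ordered_pair k u v : bool :=
  (0 <= omega k u v) && ((omega k u v == 0) ==> (sform u v == 0)).

Lemma ordered_pairD k u v1 v2 : ordered_pair k v1 u -> ordered_pair k v2 u ->
  ordered_pair k (v1 + v2) u.
Proof.
move=> /andP[o1 /implyP z1] /andP[o2 /implyP z2].
rewrite /ordered_pair omegaDl sformDl addr_ge0 //=; apply/implyP.
by rewrite paddr_eq0 // => /andP[/z1/eqP-> /z2/eqP->]; rewrite addr0.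
Qed.

Lemma ordered_pairZ k u v a : 0 <= a -> ordered_pair k v u -> ordered_pair k (a *: v) u.
Proof.
move=> a0 /andP[o1 /implyP z1]; rewrite /ordered_pair omegaZl sformZl mulr_ge0 //=.
by apply/implyP; rewrite !mulf_eq0 => /orP[->//|/z1->]; rewrite orbT.
Qed.

Lemma ordered_pair_letter k v : proot v -> v <> sroot (letter k) ->
  ordered_pair k (sroot (letter k)) v.
Proof.
move=> pv vs; rewrite /ordered_pair (omega_letter_ge0 K _ pv.2) /=.
by apply/implyP => /eqP /(omega_letter_eq0 pv vs) e; rewrite sform_sroot e.
Qed.

(* The inversions of an aligned element, in the order of its sorting word. The
   hypothesis on shorter elements is discharged in [aligned_skip]. *)
Lemma aligned_ordered N k w : (ell w < N)%N ->
  (forall l x, (ell x < N)%N -> aligned l x -> ~ desc (letter l) x ->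
     avoids (letter l) x) ->
  aligned k w -> exists a, [/\ wp a = w, pairwise (ordered_pair k) (inv_seq a),
    forall v, v \in inv_seq a -> inv w v & forall s, avoids s w -> s \notin a].
Proof.
move=> + skip; move: k w; apply: sorting_ind => [k _ _|k w ds IH ltN al|k w nds IH ltN al].
- by exists [::]; split=> //; rewrite word_prod_nil.
- have [||a [aE pa ia na]] := IH; first by rewrite (length_desc ds) in ltN; lia.
    exact/(aligned_take ds).
  exists (letter k :: a); split=> /=.
  + by rewrite word_prod_cons aE gen_mulKg.
  + rewrite all_map pairwise_map; apply/andP; split.
      apply/allP => v /ia iv /=; apply: ordered_pair_letter.
        exact: (inv_refl_desc ds iv).1.
      exact: sroot_not_refl iv.1.2.
    apply: sub_pairwise pa => u v /=.
    by rewrite /ordered_pair -(omega_refl K k) !reflK sform_refl.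
  + move=> v; rewrite inE => /orP[/eqP->//|/mapP[u /ia iu ->]].
    exact: inv_refl_desc iu.
  + move=> s av; have sk : letter k != s.
      by apply/eqP => e; apply: (avoids_ndesc av); rewrite -e.
    by rewrite inE negb_or eq_sym sk; apply: na; apply/(avoids_mul sk ds).
- have av := skip _ _ ltN al nds.
  have [//||a [aE pa ia na]] := IH; first exact/(aligned_avoids av).
  exists a; split=> //; 
  apply: (@sub_in_pairwise _ (mem (inv_seq a)) (ordered_pair k.+1)) pa; last exact/allP.
  by move=> u v /ia/av us /ia/av vs; rewrite /ordered_pair omegaS.
Qed.

Lemma act_rcons_sroot a i s : s != i ->
  act (rcons a i) (sroot s) = act a (sroot s) + K i s *: act a (sroot i).
Proof.
rewrite eq_sym => /negPf is_; rewrite -cats1 act_cat /= /refl bil_sroot /cartan is_.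
by rewrite scaleNr opprK -!(rho_word K) rhoD rhoZ.
Qed.

(** Removing letters from the right writes [act a (sroot s)] as a nonnegative combination of
    [sroot s] and the members of [inv_seq a], so every convex cone containing these contains it. *)
Lemma act_sroot_closed (Q : V -> Prop) a s :
  (forall u v, Q u -> Q v -> Q (u + v)) ->
  (forall c v, 0 <= c -> Q v -> Q (c *: v)) ->
  s \notin a -> Q (sroot s) -> (forall v, v \in inv_seq a -> Q v) ->
  Q (act a (sroot s)).
Proof.
move=> QD QZ + Qs; elim/last_ind: a => [//|a i IHa].
rewrite inv_seq_rcons mem_rcons inE negb_or => /andP[si sa] Qa.
rewrite act_rcons_sroot //; apply: QD.
  by apply: IHa => // v va; apply: Qa; rewrite mem_rcons inE va orbT.
apply: QZ; first by apply: kap_ge0; rewrite eq_sym.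
by apply: Qa; rewrite mem_rcons inE eqxx.
Qed.

(** Removing the last letter [i] writes the inversion as [act a (sroot s)] plus a multiple of the
    last member [t] of the sequence; alignment makes the first summand an inversion, and so on down
    to [sroot s]. *)
Lemma aligned_descend k w a :
  (forall v, v \in inv_seq a -> proot v /\ v 0 (letter k) = 0) ->
  pairwise (ordered_pair k) (inv_seq a) -> letter k \notin a -> aligned k w ->
  inv w (act a (sroot (letter k))) -> desc (letter k) w.
Proof.
set s := letter k; move=> ia pa sa al.
elim/last_ind: a ia pa sa => [//|a i IHa]; rewrite inv_seq_rcons => ia pa.
rewrite mem_rcons inE negb_or => /andP[si sa].
set t := act a (sroot i) in ia pa *.
have [pt ts] : proot t /\ t 0 s = 0 by apply: ia; rewrite mem_rcons inE eqxx.
have ia' v : v \in inv_seq a -> proot v /\ v 0 s = 0.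
  by move=> va; apply: ia; rewrite mem_rcons inE va orbT.
rewrite pairwise_rcons in pa; case/andP: pa => /allP at_ pa.
rewrite act_rcons_sroot // -/t => iv; apply: IHa => //.
have [K0|K0] := eqVneq (K i s) 0; first by rewrite K0 scale0r addr0 in iv.
have Kpos : 0 < K i s by rewrite lt_neqAle eq_sym K0 kap_ge0 // eq_sym.
rewrite -[act a _]scale1r in iv; apply: (al _ t 1 (K i s)) => //.
  split; first by rewrite -(rho_word K); exact/root_rho/root_sroot.
  apply: (@act_sroot_closed (@nonneg R n)) => //.
  - exact: nonnegD.
  - by move=> c v; exact: nonnegZ.
  - exact: nonneg_sroot.
  - by move=> v /ia'[[]].
(* The first summand lies in the cone of roots ordered before [t]; since its [sform] with [t] is
   [- K i s], nonzero, the sign of [omega] is strict. *)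
have /andP[o0 /implyP oz] : ordered_pair k (act a (sroot s)) t.
  apply: (@act_sroot_closed (fun v => ordered_pair k v t)) => //.
  - by move=> u v; exact: ordered_pairD.
  - by move=> c v; exact: ordered_pairZ.
  - apply: ordered_pair_letter => // e; move: ts; rewrite e srootE eqxx => /eqP.
    by rewrite oner_eq0.
rewrite lt_neqAle o0 andbT eq_sym; apply: contra K0 => /oz.
rewrite /t -!(rho_word K) sform_rho sform_sroot bil_sroot /cartan (negPf si).
by rewrite oppr_eq0 (kap_sym K).
Qed.

(** If the parabolic part [x] is not all of [w], some cover [x * g i] lies below [w]. It must have
    [i = s], and [aligned_descend], along a word of [x] ordered by the induction hypothesis, makes
    [s] a descent of [w]. *)
Lemma aligned_skip k w : aligned k w -> ~ desc (letter k) w -> avoids (letter k) w.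
Proof.
have [N] := ubnP (ell w); elim: N k w => // N IHN k w ltN al nds.
set s := letter k in nds *; have [x [xw xs xP]] := exists_parabolic_part s w.
have [<-//|xnw] := EM (x = w).
exfalso; apply: nds; have ltx := wle_neq_length xw xnw.
have alx : aligned k x.
  by apply: (aligned_restrict (J := [set~ s]) al) => v; rewrite xP on_setC1.
have ltxN : (ell x < N)%N by lia.
have [a [aE pa ia na]] := aligned_ordered ltxN IHN alx.
have sa := na _ xs.
have [|i di] := @exists_desc _ _ _ _ K (x^-1 * w)%g.
  by move=> e; apply: xnw; rewrite -[LHS]mulg1 -e mulVKg.
have iw := inv_left_factor xw di.
suff es : i = s.
  apply: (aligned_descend (a := a)) => //; last by rewrite -(rho_word K) aE -/s -es.
  by move=> v /ia iv; split; [exact: iv.1 | exact: xs].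
(* For [i] other than [s] the added root has no [s] coordinate, so it would already be an inversion
   of [x], yet [x^-1] sends it to [sroot i]. *)
apply/eqP/negPn/negP => ne; have /xP ix : inv w (rho x (sroot i)) /\ rho x (sroot i) 0 s = 0.
  split=> //; rewrite -aE rho_word.
  have coord b v : s \notin b -> act b v 0 s = v 0 s.
    elim: b => //= j b IHb; rewrite inE negb_or => /andP[sj sb].
    by rewrite refl_coord // IHb.
  by rewrite coord // srootE (negPf ne).
by apply: (inv_not_nonneg ix); rewrite rhoK; exact: nonneg_sroot.
Qed.

End Aligned.

(** * Joins of aligned elements *)

Section Joins.
Variables (R : realFieldType) (W : groupType) (n' : nat).
Local Notation n := n'.+1.
Variables (C : coxeter_system W n) (K : cosine_matrix C R).
Local Notation g := (cox_gen C).
Local Notation ell := (cox_length C).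
Local Notation V := 'rV[R]_n.
Local Notation sroot := (@sroot R n).
Local Notation rho := (rho K).
Local Notation refl := (refl K).
Local Notation proot := (proot K).
Local Notation inv := (inv K).
Local Notation desc := (desc K).
Local Notation wle := (wle K).
Local Notation euler := (euler K).
Local Notation omega := (omega K).
Local Notation letter := (letter n').
Local Notation avoids := (avoids K).
Local Notation aligned := (aligned K).
Implicit Types (u v : V) (i j r s q : 'I_n) (w x y z : W) (k : nat).

Lemma inv_gen s v : inv (g s) v <-> v = sroot s.
Proof.
have ds : desc s (g s).
  by apply/descP; rewrite gen_mulK length1; have := length_gen_mul C s 1%g;
    rewrite mulg1 length1; lia.
by rewrite (inv_desc _ ds) gen_mulK; split=> [[//|/inv1//]|]; left.
Qed.

Lemma gen_le s w : wle (g s) w <-> desc s w.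
Proof. by split=> [|ds v /inv_gen->//]; apply; apply/inv_gen. Qed.

Lemma aligned_gen k s : aligned k (g s).
Proof.
move=> v1 v2 a c p1 p2 a0 c0 /inv_gen e _; apply/inv_gen.
by case: (proot_sum_sroot p1 p2 a0 c0 e).
Qed.

Lemma avoids_gen s q : s != q -> avoids q (g s).
Proof. by move=> sq v /inv_gen->; rewrite srootE (negPf sq). Qed.

(* Below a common bound of [q] and [s] lies the longest element of the dihedral
   subgroup they generate. *)
Lemma exists_dihedral q s w : desc q w -> desc s w -> exists2 d, wle d w &
  forall v, inv d v <-> proot v /\ on [set q; s]%SET v.
Proof.
move=> dq ds; have [d [dw dP]] := exists_restrict K [set q; s]%SET w.
exists d => // v; rewrite dP; split=> [[iv von]|[pv von]]; first by split=> //; case: iv.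
split=> //; have [qs|qs] := eqVneq q s.
  suff -> : v = sroot s by [].
  apply: (proot_only_sroot pv) => i is_; apply: von.
  by rewrite qs !inE orbb.
have vE : v = v 0 q *: sroot q + v 0 s *: sroot s.
  apply/rowP => i; rewrite mxE [X in X + _]mxE [X in _ + X]mxE !srootE.
  have [<-|qi] := eqVneq q i; first by rewrite eq_sym (negPf qs) mulr1 mulr0 addr0.
  have [<-|si] := eqVneq s i; first by rewrite mulr1 mulr0 add0r.
  by rewrite !mulr0 addr0 von // !inE ![i == _]eq_sym (negPf qi) (negPf si).
by rewrite vE in pv *; apply: inv_conv => //; have := pv.2; rewrite -vE; apply.
Qed.

Lemma aligned_dihedral k q s d :
  (forall v, inv d v <-> proot v /\ on [set q; s]%SET v) -> aligned k d.
Proof.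
move=> dP v1 v2 a c p1 p2 a0 c0 /dP[_ von] _; apply/dP; split=> // i /von.
by move=> /(coord_sum_eq0 p1.2 p2.2 a0 c0)[].
Qed.

(** The last clause makes [x] maximal among the aligned elements below [w] without the inversion
    [t]. The induction follows the sorting word until [t] becomes the initial simple root; there the
    form reads off a coordinate, and [x] is the parabolic part. *)
Lemma exists_shear k w t : aligned k w -> inv w t -> exists x,
  [/\ aligned k x, forall v, inv x v <-> inv w v /\ euler k v t <= 0 &
    forall y, aligned k y -> wle x y -> wle y w -> ~ inv y t -> wle y x].
Proof.
move: k w t; apply: sorting_ind => [k t _ /inv1//|k w ds IH t al it|k w nds IH t al it].
  set s := letter k in ds IH; have [ts|ts] := EM (t = sroot s).
    have [x [xw xs xP]] := exists_parabolic_part K s w; exists x; split.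
    - by apply: (aligned_restrict (J := [set~ s]) al) => v; rewrite xP on_setC1.
    - move=> v; rewrite xP ts euler_letterr -/s; split=> [[iv ->]//|[iv vs]].
      by split=> //; apply/eqP; rewrite eq_le vs; exact: iv.1.2.
    - move=> y aly xy yw nyt v iv; apply/xP; split; first exact: yw.
      by apply: (aligned_skip aly) => //; rewrite ts in nyt.
  have [x [alx xP xmax]] := IH _ (iffLR (aligned_take ds) al) (inv_desc_refl ds it ts).
  have ndx : ~ desc s x by move=> /xP[/(desc_mul ds)].
  have dsx := ndesc_mul ndx.
  have sxP v : inv (g s * x)%g v <-> inv w v /\ euler k v t <= 0.
    rewrite (inv_desc _ dsx) gen_mulKg xP (inv_desc _ ds) euler_refl.
    split=> [[->|[]]|[[]]]; auto; split; first by left.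
    (* The value at [sroot s] is minus the [s] coordinate of the positive root [refl s t], so
       [sroot s] is retained. *)
    rewrite euler_letterl -/s -opprB oppr_le0 -refl_coord_same.
    exact: (proot_refl it.1 ts).2.
  exists (g s * x)%g; split=> //; first by apply/(aligned_take dsx); rewrite gen_mulKg.
  move=> y aly xy yw nyt; have dy := wle_desc xy dsx.
  apply/(wle_strip dy dsx); rewrite gen_mulKg; apply: xmax.
  - exact/(aligned_take dy).
  - by rewrite -[x](gen_mulKg C s); apply/(wle_strip dsx dy).
  - exact/(wle_strip dy ds).
  - by move=> /(inv_refl_desc dy); rewrite reflK.
have av := aligned_skip al nds.
have [x [alx xP xmax]] := IH _ (iffLR (aligned_avoids av) al) it.
have xP' v : inv x v <-> inv w v /\ euler k v t <= 0.
  rewrite xP; split=> -[iv]; rewrite ?eulerS //; try exact: av;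
    by rewrite -eulerS //; exact: av.
have ax : avoids (letter k) x by move=> v /xP[/av].
exists x; split=> //; first exact/(aligned_avoids ax).
move=> y aly xy yw nyt; apply: xmax => //.
exact/(aligned_avoids (avoids_le yw av)).
Qed.

(* minimal, and by [minub_uniq] least, upper bounds in the weak order *)
Definition minub x y z : Prop :=
  [/\ wle x z, wle y z & forall w, wle x w -> wle y w -> wle w z -> w = z].

Lemma minubC x y z : minub x y z -> minub y x z.
Proof. by move=> [xz yz h]; split=> // u yu xu; exact: h. Qed.

Lemma exists_minub x y w : wle x w -> wle y w -> exists2 z, minub x y z & wle z w.
Proof.
move=> xw yw; pose P m := `[< exists z, [/\ wle x z, wle y z, wle z w & ell z = m] >].
have exP : exists m, P m by exists (ell w); apply/asboolP; exists w; split.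
have [m /asboolP[z [xz yz zw zm]] minm] := ex_minnP exP.
exists z => //; split=> // u xu yu uz; apply: (wle_anti_length uz).
rewrite zm; apply: minm; apply/asboolP; exists u; split=> //.
exact: wle_trans uz zw.
Qed.

Lemma minub1 x z : minub x 1%g z -> z = x.
Proof. by move=> [xz _ h]; rewrite -(h x) //; exact: wle1. Qed.

Lemma minub_strip s x y z : desc s x -> desc s y -> minub x y z ->
  minub (g s * x)%g (g s * y)%g (g s * z)%g.
Proof.
move=> dx dy [xz yz h]; have dz := wle_desc xz dx.
split; [exact/(wle_strip dx dz) | exact/(wle_strip dy dz) | move=> u xu yu uz].
have ndu : ~ desc s u by move=> /uz/(desc_mul dz).
have du := ndesc_mul ndu; rewrite -[u](gen_mulKg C s); congr (_ * _)%g.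
by apply: h; [apply/(wle_strip dx du) | apply/(wle_strip dy du) | apply/(wle_strip du dz)];
  rewrite gen_mulKg.
Qed.

Lemma minub_replace x y y' z : minub x y z -> wle y y' -> wle y' z -> minub x y' z.
Proof.
move=> [xz yz h] yy' y'z; split=> // u xu y'u; apply: h => //; exact: wle_trans yy' y'u.
Qed.

Lemma minub_avoids s x y z : avoids s x -> avoids s y -> minub x y z -> avoids s z.
Proof.
move=> ax ay [xz yz h]; have [u [uz au uP]] := exists_parabolic_part K s z.
rewrite -(h u) // => v iv; apply/uP; split; [exact: xz|exact: ax|exact: yz|exact: ay].
Qed.

(** Induction on the total length of the bounds. A common descent of [x] and [y] is stripped;
    otherwise a descent [s] of [x] is created in [y] by replacing [y] with its join with [g s],
    whose uniqueness is the case of a generator. *)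
Lemma minub_uniq x y z1 z2 : minub x y z1 -> minub x y z2 -> z1 = z2.
Proof.
have [N] := ubnP (ell z1 + ell z2)%N; elim: N x y z1 z2 => // N IHN x y z1 z2 ltN.
have strip q a b c1 c2 : (ell c1 + ell c2 < N.+1)%N -> desc q a -> desc q b ->
    minub a b c1 -> minub a b c2 -> c1 = c2.
  move=> ltc da db m1 m2; apply: (mulgI (g q)).
  have [wle1 le2] : wle a c1 /\ wle a c2 by case: m1; case: m2.
  have := length_desc (wle_desc wle1 da); have := length_desc (wle_desc le2 da) => l1 l2.
  by apply: (IHN _ _ _ _ _ (minub_strip da db m1) (minub_strip da db m2)); lia.
have gen s b c1 c2 : (ell c1 + ell c2 < N.+1)%N -> ~ desc s b ->
    minub (g s) b c1 -> minub (g s) b c2 -> c1 = c2.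
  move=> ltc ndb m1 m2; have [b1|b1] := EM (b = 1%g).
    by rewrite b1 in m1 m2; rewrite (minub1 m1) (minub1 m2).
  (* The longest element of the dihedral subgroup of [q] and [s] is the same below both bounds;
     replacing [g s] by it gives the common descent [q]. *)
  have [q dq] := exists_desc K b1; have [s1 q1 _] := m1; have [s2 q2 _] := m2.
  have [d d1 dP] := exists_dihedral (wle_desc q1 dq) (iffLR (gen_le _ _) s1).
  have [d' d2 dP'] := exists_dihedral (wle_desc q2 dq) (iffLR (gen_le _ _) s2).
  have ed : d' = d.
    by apply: (@wle_anti _ _ _ _ K) => v; [move=> /dP'/dP | move=> /dP/dP'].
  have sd : wle (g s) d.
    apply/gen_le/dP; split; first exact: proot_sroot.
    by apply/on_sroot; rewrite !inE eqxx orbT.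
  have qd : desc q d.
    by apply/dP; split; [exact: proot_sroot | apply/on_sroot; rewrite !inE eqxx].
  have r1 := minub_replace (minubC m1) sd d1.
  have r2 := minub_replace (minubC m2) sd (eq_ind d' (fun x => wle x c2) d2 d ed).
  exact: strip ltc dq qd r1 r2.
move=> m1 m2; have [x1|/(exists_desc K)[s dx]] := EM (x = 1%g).
  by rewrite x1 in m1 m2; rewrite (minub1 (minubC m1)) (minub1 (minubC m2)).
have [dy|ndy] := EM (desc s y); first exact: strip ltN dx dy m1 m2.
have [xz1 yz1 _] := m1; have [xz2 yz2 _] := m2.
have [c1 mc1 c1z] := exists_minub (iffRL (gen_le _ _) (wle_desc xz1 dx)) yz1.
have [c2 mc2 c2z] := exists_minub (iffRL (gen_le _ _) (wle_desc xz2 dx)) yz2.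
have ec : c2 = c1.
  apply: gen mc2 mc1 => //; have := wle_length c1z; have := wle_length c2z; lia.
rewrite ec in mc2 c2z; have [sc1 yc1 _] := mc1.
exact: strip ltN dx (iffLR (gen_le _ _) sc1) (minub_replace m1 yc1 c1z)
  (minub_replace m2 yc1 c2z).
Qed.

Lemma minub_least x y z w : minub x y z -> wle x w -> wle y w -> wle z w.
Proof.
by move=> m xw yw; have [z' m' z'w] := exists_minub xw yw; rewrite (minub_uniq m m').
Qed.

Section StrongInduction.
Variable N : nat.
Hypothesis IHN : forall k x y z, (ell z < N)%N -> aligned k x -> aligned k y ->
  minub x y z -> aligned k z.

(** If the initial letter [q] is a descent of [y], enlarge [g s] to a dihedral longest element and
    strip [q]. Otherwise rotate: for [s] other than [q] the join still avoids [q], and for [s = q]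
    the reflection symmetry of the inversions of [z] undoes the rotation. *)
Lemma aligned_join_gen k y s z : (ell z < N.+1)%N -> avoids s y -> aligned k y ->
  minub (g s) y z -> aligned k z.
Proof.
move: k y; apply: sorting_ind => [k|k y dy _|k y ndy IH] ltz ay aly m.
- by rewrite (minub1 m); exact: aligned_gen.
- set q := letter k in dy; have [sz yz _] := m.
  have dqz := wle_desc yz dy; have dsz := iffLR (gen_le _ _) sz.
  have [d dz dP] := exists_dihedral dqz dsz.
  have sd : wle (g s) d.
    apply/gen_le/dP; split; first exact: proot_sroot.
    by apply/on_sroot; rewrite !inE eqxx orbT.
  have qd : desc q d.
    by apply/dP; split; [exact: proot_sroot | apply/on_sroot; rewrite !inE eqxx].
  have m' := minub_strip dy qd (minub_replace (minubC m) sd dz).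
  apply/(aligned_take dqz); apply: IHN m'.
  + by rewrite (length_desc dqz) in ltz.
  + exact/(aligned_take dy).
  + by apply/(aligned_take qd); exact: aligned_dihedral dP.
set q := letter k in ndy; have ayq := aligned_skip aly ndy.
have alz : aligned k.+1 z by apply: IH => //; exact/(aligned_avoids ayq).
have [sz yz zmin] := m.
have [eqs|qs] := EM (s = q); last first.
  have aq : avoids q z by apply: minub_avoids ayq m; apply: avoids_gen; apply/eqP.
  exact/(aligned_avoids aq).
have ynz : y <> z.
  by move=> e; apply: (avoids_ndesc ay); rewrite e; apply/gen_le.
have [r [yzr irz zrP]] := lower_cover yz ynz.
have rE : rho z (sroot r) = - sroot s.
  (* A lower cover of [z] above [y] that kept [sroot s] would be a smaller upper bound. *)
  apply: contrapT => ne; have nle : ~ wle z (z * g r)%g by move=> h; case/zrP: (h _ irz).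
  apply: nle; rewrite (zmin (z * g r)%g) //; last by move=> v /zrP[].
  move=> v /inv_gen->; apply/zrP; split; first exact/gen_le.
  by move=> e; apply: ne; rewrite e opprK.
have stable := inv_refl_stable rE; rewrite eqs in stable.
have dqz : desc q z by rewrite -eqs; exact/gen_le.
move=> v1 v2 a c p1 p2 a0 c0 iv om.
have [->//|v1q] := EM (v1 = sroot q).
have v2q : v2 <> sroot q.
  move=> e; move: om; rewrite e omegaC oppr_gt0 ltNge.
  by rewrite omega_letter_ge0 //; exact: p1.2.
have sumN : a *: v1 + c *: v2 <> sroot q.
  by move=> e; apply: v1q; case: (proot_sum_sroot p1 p2 a0 c0 e).
have := stable _ iv sumN; rewrite reflD !reflZ => ivq.
rewrite -[v1](reflK K q); apply: stable; last exact: sroot_not_refl p1.2.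
(* Alignment in the rotated order is applied to the reflected roots, whose pairing there equals that
   of [v1] and [v2] in the original order. *)
apply: (alz (refl q v1) (refl q v2) a c) => //; try exact: proot_refl.
by rewrite omega_refl.
Qed.

End StrongInduction.

(** If the initial letter is a descent of both, strip it; if of one only, first join the other with
    that letter; if of neither, rotate. *)
Theorem aligned_join k x y z : aligned k x -> aligned k y -> minub x y z -> aligned k z.
Proof.
have [N] := ubnP (ell z); elim: N k x y z => // N IHN k x y z.
have strip l a b c : (ell c < N.+1)%N -> desc (letter l) a -> desc (letter l) b ->
    aligned l a -> aligned l b -> minub a b c -> aligned l c.
  move=> ltc da db ala alb m; have [ac _ _] := m; have dc := wle_desc ac da.
  apply/(aligned_take dc); apply: IHN (minub_strip da db m).
  - by rewrite (length_desc dc) in ltc.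
  - exact/(aligned_take da).
  - exact/(aligned_take db).
have half l a b c : (ell c < N.+1)%N -> desc (letter l) a -> ~ desc (letter l) b ->
    aligned l a -> aligned l b -> minub a b c -> aligned l c.
  move=> ltc da ndb ala alb m; have [ac bc _] := m.
  have [d md dc] := exists_minub (iffRL (gen_le _ _) (wle_desc ac da)) bc.
  have ltd : (ell d < N.+1)%N by have := wle_length dc; lia.
  have ald := aligned_join_gen IHN ltd (aligned_skip alb ndb) alb md.
  have [sd bd _] := md.
  exact: strip ltc da (iffLR (gen_le _ _) sd) ala ald (minub_replace m bd dc).
move: k x y z; apply: sorting_ind => [k|k x dx _|k x ndx IH] y z ltz alx aly m.
- by rewrite (minub1 (minubC m)).
- have [dy|ndy] := EM (desc (letter k) y); first exact: strip ltz dx dy alx aly m.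
  exact: half ltz dx ndy alx aly m.
have [dy|ndy] := EM (desc (letter k) y); first exact: half ltz dy ndx aly alx (minubC m).
have ax := aligned_skip alx ndx; have ay := aligned_skip aly ndy.
apply/(aligned_avoids (minub_avoids ax ay m)); apply: IH m => //.
- exact/(aligned_avoids ax).
- exact/(aligned_avoids ay).
Qed.

Lemma euler_self k v : cox_root K v -> euler k v v = 1.
Proof.
by move=> /sform_root; rewrite -(euler_sym K k) => h; lra.
Qed.

(** If the parabolic part [y] of [z] exceeded [x], the root [t] of a lower cover of [y] above [x]
    would allow [exists_shear] to cut [z] down to a smaller upper bound. *)
Theorem join_letter_parabolic k x z : avoids (letter k) x -> aligned k x ->
  minub (g (letter k)) x z -> forall v, inv z v -> v 0 (letter k) = 0 -> inv x v.
Proof.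
set s := letter k; move=> ax alx m; have [sz xz zmin] := m.
have alz := aligned_join (@aligned_gen k s) alx m.
have [y [yz ay yP]] := exists_parabolic_part K s z.
have xy : wle x y by move=> v iv; apply/yP; split; [exact: xz | exact: ax].
suff -> : x = y by move=> v iv vs; apply/yP.
apply: contrapT => xny; have [r [xyr iyt yrP]] := lower_cover xy xny.
set t := - rho y (sroot r) in iyt yrP; have it := iyt.1.1.
have aly : aligned k y.
  by apply: (aligned_restrict (J := [set~ s]) alz) => v; rewrite yP on_setC1.
have [a [ala aP amax]] := exists_shear aly iyt.
have tNa : ~ inv a t by move=> /aP[_]; rewrite (euler_self k it) lt_geF ?ltr01.
have ayr : wle a (y * g r)%g.
  by move=> v iv; apply/yrP; split; [case/aP: iv | move=> e; rewrite e in iv].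
have [b mb byr] := exists_minub xyr ayr; have [xb ab _] := mb.
(* The join [b] of [x] and [a] is aligned and lacks [t], so maximality of [a] absorbs it: every
   inversion of [x] pairs nonpositively with [t]. *)
have xa : wle x a.
  apply: wle_trans xb _; apply: amax => //; first exact: aligned_join alx ala mb.
    by move=> v /byr/yrP[].
  by move=> /byr/yrP[].
have izt : inv z t by apply: yz.
(* The part [c] of [z] contains both [x] and [sroot s], so it equals [z]; but [t] is an inversion of
   [z] with [euler k t t = 1]. *)
have [c [alc cP _]] := exists_shear alz izt.
suff ez : c = z.
  have /cP[_] : inv c t by rewrite ez.
  by rewrite (euler_self k it) lt_geF ?ltr01.
apply: zmin; last by move=> v /cP[].
  move=> v /inv_gen->; apply/cP; split; first exact/gen_le.
  rewrite euler_letterl -/s -opprB oppr_le0 -refl_coord_same.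
  apply: (proot_refl iyt.1 _).2 => e.
  by have := ay _ iyt; rewrite e srootE eqxx => /eqP; rewrite oner_eq0.
by move=> v iv; apply/cP; split; [exact: xz | case/xa/aP: iv].
Qed.

End Joins.

(** * Sorting words *)

Section SortingWords.
Variables (R : realFieldType) (W : groupType) (n' : nat).
Local Notation n := n'.+1.
Variables (C : coxeter_system W n) (K : cosine_matrix C R).
Local Notation g := (cox_gen C).
Local Notation ell := (cox_length C).
Local Notation desc := (desc K).
Local Notation letter := (letter n').
Local Notation avoids := (avoids K).
Local Notation aligned := (aligned K).
Implicit Types (w x y z : W) (k p : nat) (d : seq (nat * 'I_n)).

(* positions, counted from 1, that the greedy algorithm started after position
   [k] uses for [w] *)
Inductive used : nat -> W -> nat -> Prop :=
| used_here k w : desc (letter k) w -> used k w k.+1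
| used_take k w p : desc (letter k) w -> used k.+1 (g (letter k) * w)%g p -> used k w p
| used_skip k w p : ~ desc (letter k) w -> used k.+1 w p -> used k w p.

Lemma used_gt k w p : used k w p -> (k < p)%N.
Proof. by elim=> // {w p} {}k w p _ _ /ltnW. Qed.

Lemma used_takeP k w p : desc (letter k) w ->
  used k w p <-> p = k.+1 \/ used k.+1 (g (letter k) * w)%g p.
Proof.
move=> dk; split=> [u|[->|u]]; [|exact: used_here|exact: used_take].
by inversion u; subst; [left|right|].
Qed.

Lemma used_skipP k w p : ~ desc (letter k) w -> used k w p <-> used k.+1 w p.
Proof.
move=> nd; split=> [u|]; last exact: used_skip.
by inversion u; subst.
Qed.

Lemma used1 k p : ~ used k 1%g p.
Proof.
suff h l w q : used l w q -> w = 1%g -> False by move=> /h; apply.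
by elim=> {l w q} [l w|l w q|//] dl; [|move=> _ _] => w1; rewrite w1 in dl; case: (inv1 dl).
Qed.

Lemma used_first k w : used k w k.+1 <-> desc (letter k) w.
Proof.
split=> [u|]; last exact: used_here.
by apply: contrapT => nd; move/(used_skipP _ nd)/used_gt: u; rewrite ltnn.
Qed.

Lemma avoids_used s k w p : avoids s w -> used k w p -> letter p.-1 <> s.
Proof.
move=> + u; elim: u => {k w p} [k w dk|k w p dk _ IH|k w p _ _ IH] aw //=; last exact: IH.
  by move=> e; apply: (avoids_ndesc aw); rewrite -e.
have ks : letter k != s by apply/eqP => e; apply: (avoids_ndesc aw); rewrite -e.
by apply: IH; apply/(avoids_mul ks dk).
Qed.

Lemma used_avoids s k w : (forall p, used k w p -> letter p.-1 <> s) -> avoids s w.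
Proof.
move: k w; apply: sorting_ind => [k _|k w dk IH us|k w nd IH us].
- exact: avoids1.
- have ks : letter k != s by apply/eqP; exact: us (used_here dk).
  by apply/(avoids_mul ks dk)/IH => p /(used_take dk)/us.
- by apply: IH => p /(used_skip nd)/us.
Qed.

(** Positions [p] and [p + n] carry the same letter in consecutive blocks, so this is nesting of
    blocks for the word started after position [k]. *)
Definition nested k w : Prop := forall p, (k < p)%N -> used k w (p + n)%N -> used k w p.

(** Both properties obey the same recursion: strip the initial letter if it is a descent, otherwise
    require that [w] avoid it. *)
Lemma aligned_nested k w : aligned k w <-> nested k w.
Proof.
move: k w; apply: sorting_ind => [k|k w dk IH|k w nd IH].
- by split=> [_ p _ /used1//|_]; exact: aligned1.
- rewrite (aligned_take dk) IH; split=> nest p ltp.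
    move=> /(used_takeP _ dk)[|u]; first by lia.
    apply/(used_takeP _ dk); have [->|pk] := eqVneq p k.+1; [by left|right].
    by apply: nest => //; lia.
  move=> u; have /(used_takeP _ dk)[e|//] : used k w p; last by lia.
  by apply: nest; [lia|exact: used_take].
have av_period : avoids (letter k) w -> forall p, ~ used k w (k.+1 + p * n)%N.
  move=> av p u; apply: (avoids_used av u); apply: val_inj => /=.
  by rewrite addnC modnMDl.
split=> [al|nest].
  have av := aligned_skip al nd; have nest := iffLR IH (iffLR (aligned_avoids av) al).
  move=> p ltp u; have [e|pk] := eqVneq p k.+1.
    by case: (av_period av 1%N); rewrite mul1n -e.
  apply/(used_skipP _ nd)/nest; first by lia.
  exact/(used_skipP _ nd).
(* By nesting, a letter missing from its first block is missing from all later ones. *)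
have nper p : ~ used k w (k.+1 + p * n)%N.
  elim: p => [|p IHp]; first by rewrite mul0n addn0 => /used_first.
  by move=> u; apply: IHp; apply: nest; [lia | move: u; rewrite mulSn; congr used; lia].
have av : avoids (letter k) w.
  apply: (@used_avoids _ k) => p u e; have := used_gt u => ltp.
  apply: (nper ((p - k.+1) %/ n)%N).
  have dv : (n %| p - k.+1)%N.
    have -> : (p - k.+1 = p.-1 - k)%N by lia.
    by rewrite -eqn_mod_dvd; [exact/eqP/(congr1 val e)|lia].
  by rewrite divnK // subnKC.
apply/(aligned_avoids av)/IH => p ltp /(used_skip nd) u.
by apply/(used_skipP _ nd); apply: nest u; lia.
Qed.

Definition place k : nat * 'I_n := ((k %/ n)%N, letter k).

Lemma pos_place k : pos (place k) = k.+1.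
Proof. by rewrite /pos /= addnS -divn_eq. Qed.

Lemma place_pos (q : nat * 'I_n) : place (pos q).-1 = q.
Proof.
case: q => i j; rewrite /place /pos addnS /=; congr pair.
  by rewrite divnMDl // divn_small // addn0.
by apply: val_inj; rewrite /= modnMDl modn_small.
Qed.

Lemma pos_inj : injective (@pos n).
Proof. by apply: can_inj (fun p => place p.-1) _ => q; exact: place_pos. Qed.

Definition subword_from k w d : Prop :=
  reduced_subword C w d /\ all (ltn k) (map (@pos n) d).

Lemma subword_from_cons k w d : desc (letter k) w ->
  subword_from k.+1 (g (letter k) * w)%g d -> subword_from k w (place k :: d).
Proof.
move=> dk [[sd pd szd] ald]; split; last first.
  rewrite /= pos_place ltnSn /=; apply: sub_all ald => p; exact: ltnW.
split; rewrite /= ?word_prod_cons ?pd ?gen_mulKg ?szd ?(length_desc dk) //.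
by rewrite (path_sortedE ltn_trans) pos_place ald.
Qed.

Lemma subword_from_weaken k w d : subword_from k.+1 w d -> subword_from k w d.
Proof. by move=> [rd ald]; split=> //; apply: sub_all ald => p; exact: ltnW. Qed.

Lemma exists_subword_from k w : exists d, subword_from k w d.
Proof.
move: k w; apply: (@sorting_ind _ _ _ _ K) => [k|k w dk [d sd]|k w nd [d sd]].
- by exists [::]; split=> //; split=> //=; rewrite ?word_prod_nil ?length1.
- by exists (place k :: d); exact: subword_from_cons dk sd.
- by exists d; exact: subword_from_weaken.
Qed.

Lemma lex_le_cons p q (s t : seq nat) :
  lex_le (p :: s) (q :: t) = (p <= q)%N && ((q <= p)%N ==> lex_le s t).
Proof. by []. Qed.

(** The lexicographically first reduced subword is the greedy one: a descent can be taken at once,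
    and a letter that is not a descent cannot begin a reduced word. *)
Lemma lex_first_used k w d : subword_from k w d ->
  (forall d', subword_from k w d' -> lex_le (map (@pos n) d) (map (@pos n) d')) ->
  forall p, (p \in map (@pos n) d) <-> used k w p.
Proof.
move: k w d; apply: sorting_ind => [k d|k w dk IH d|k w nd IH d] sd mind p.
- have [[_ _ szd] _] := sd; rewrite length1 in szd; rewrite (size0nil szd).
  by split=> // /used1.
- have [[srt pd szd] ald] := sd; rewrite (length_desc dk) in szd.
  case: d srt pd szd ald sd mind => //= q d srt pd [szd] /andP[ltq ald] sd mind.
  have [d0 sd0] := exists_subword_from k.+1 (g (letter k) * w)%g.
  (* Comparison with a competitor starting at [k.+1], the least position allowed, fixes the first
     position. *)
  have := mind _ (subword_from_cons dk sd0); rewrite /= pos_place lex_le_cons.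
  case/andP => leq_ _; have eq1 : pos q = k.+1 by apply/eqP; rewrite eqn_leq leq_.
  have eq2 : q = place k by apply: pos_inj; rewrite eq1 pos_place.
  move: srt; rewrite (path_sortedE ltn_trans).
  rewrite eq1 => /andP[ald1 srt].
  have pd1 : word_prod g (map snd d) = (g (letter k) * w)%g.
    by rewrite -pd eq2 /= word_prod_cons gen_mulKg.
  rewrite inE (used_takeP _ dk) -(IH d) //.
  + by split=> [/orP[/eqP->|]|[->|->]]; rewrite ?eqxx ?orbT; auto.
  + move=> d' sd'; have := mind _ (subword_from_cons dk sd').
    by rewrite /= pos_place eq1 lex_le_cons leqnn.
rewrite (used_skipP _ nd); apply: IH => [|d' /subword_from_weaken/mind//].
have [[srt pd szd] ald] := sd; split=> //.
case: d srt pd szd ald {sd mind} => //= q d srt pd szd /andP[ltq ald].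
have qk : pos q != k.+1.
  apply/eqP => e; apply/nd/descP; have eq2 : q = place k.
    by apply: pos_inj; rewrite e pos_place.
  have := length_word C (map snd d); rewrite size_map => lew.
  have ed : (g (letter k) * w)%g = word_prod g (map snd d).
    by rewrite -pd eq2 /= word_prod_cons gen_mulKg.
  have := length_gen_mul C (letter k) w; rewrite ed; lia.
move: srt; rewrite (path_sortedE ltn_trans).
case/andP => ald1 _; rewrite ltn_neqAle eq_sym qk ltq /=.
by apply: sub_all ald1 => p' /=; lia.
Qed.

Lemma mem_sorting_word w p : (p \in map (@pos n) (sorting_word C w)) <-> used 0 w p.
Proof.
have [rw minw] := sorting_wordP C w.
apply: lex_first_used => [|d' [rd' _]]; last exact: minw.
split=> //; rewrite all_map; apply/allP => q _.
by rewrite /= /pos addnS.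
Qed.

Lemma cambrian_aligned w : cambrian C w <-> aligned 0 w.
Proof.
have memb i j : (j \in block C w i) <-> used 0 w (pos (i, j)).
  by rewrite inE -mem_sorting_word (mem_map pos_inj).
rewrite aligned_nested; split=> [srt p p0 u|nest i].
  have [i [j pE]] : exists i (j : 'I_n), p = pos (i, j).
    by exists (p.-1 %/ n)%N, (letter p.-1); rewrite -[RHS]/(pos (place p.-1)) pos_place prednK.
  rewrite pE; apply/memb; apply: (fintype.subsetP (srt i)); apply/memb.
  by move: u; rewrite pE /pos /= mulSn; congr used; lia.
apply/fintype.subsetP => j /memb u; apply/memb; apply: nest; first by rewrite /pos addnS.
by move: u; rewrite /pos /= mulSn; congr used; lia.
Qed.

Lemma alpha_used w : alpha C w = used 0 w.
Proof. by apply/predeqP => p; exact: mem_sorting_word. Qed.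

End SortingWords.

(** * Chains in Cambrian intervals *)

Section CambrianIntervals.
Variables (R : realFieldType) (W : groupType) (n' : nat).
Local Notation n := n'.+1.
Variables (C : coxeter_system W n) (K : cosine_matrix C R).
Local Notation g := (cox_gen C).
Local Notation desc := (desc K).
Local Notation letter := (letter n').
Local Notation avoids := (avoids K).
Local Notation aligned := (aligned K).
Local Notation wle := (wle K).
Local Notation used := (used K).
Implicit Types (w x y z : W) (k p : nat) (c : seq W).

(** Both elements are processed in parallel until [y] takes a letter that [x] cannot; so labels are
    minima of nonempty sets. *)
Lemma exists_used k x y : wle x y -> x <> y -> aligned k x -> aligned k y ->
  exists p, used k y p /\ ~ used k x p.
Proof.
move: k y x; apply: (@sorting_ind _ _ _ _ K) => [k|k y dy IH|k y ndy IH] x xy ne alx aly.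
- by case: ne; apply: (@wle_anti _ _ _ _ K) => //; exact: wle1.
- have [dx|ndx] := EM (desc (letter k) x); last first.
    by exists k.+1; split; [exact/used_first | move/used_first].
  have [||||p [py px]] := IH (g (letter k) * x)%g.
  + exact/(wle_strip dx dy).
  + by move/mulgI.
  + exact/(aligned_take dx).
  + exact/(aligned_take dy).
  exists p; split; first exact: used_take.
  move/(used_takeP _ dx) => [e|//]; have := used_gt py; lia.
have ay := aligned_skip aly ndy; have ax := avoids_le xy ay.
have [//|//|||p [py px]] := IH x; [exact/(aligned_avoids ax)|exact/(aligned_avoids ay)|].
by exists p; split; [exact: used_skip | move/(used_skipP _ (avoids_ndesc ax))].
Qed.

Definition label k x y : nat := min_nat (used k y `\` used k x)%classic.

Lemma labelP k x y : wle x y -> x <> y -> aligned k x -> aligned k y ->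
  [/\ used k y (label k x y), ~ used k x (label k x y) &
      forall p, used k y p -> ~ used k x p -> (label k x y <= p)%N].
Proof.
move=> xy ne alx aly; have [p [py px]] := exists_used xy ne alx aly.
have [|[h1 h2] minl] := @min_natP (used k y `\` used k x)%classic.
  by exists p.
by split=> // q qy qx; apply: minl.
Qed.

Definition cam_covers k x y : Prop := covers (aligned k) (weak_le C) x y.

Definition cam_chain k x y c : Prop :=
  path (fun a b => `[< cam_covers k a b >]) x c /\ last x c = y.

Lemma cam_coversP k x y : cam_covers k x y <->
  [/\ aligned k x, aligned k y, wle x y, x <> y &
      forall z, aligned k z -> wle x z -> wle z y -> z = x \/ z = y].
Proof.
have leE a b : weak_le C a b <-> wle a b by rewrite (wle_weak_le K).
split=> -[alx aly /leE xy ne h]; split=> // z alz /leE xz /leE zy; exact: h.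
Qed.

Lemma cam_covers_wle k x y : cam_covers k x y -> wle x y.
Proof. by case/cam_coversP. Qed.

Lemma cam_chain_cons k x y z c :
  cam_chain k x y (z :: c) <-> cam_covers k x z /\ cam_chain k z y c.
Proof.
rewrite /cam_chain /=; split=> [[/andP[/asboolP xz pc] lc]|[xz [pc lc]]] //.
by split=> //; rewrite pc andbT; apply/asboolP.
Qed.

Lemma cam_chain_wle k x y c : cam_chain k x y c -> wle x y.
Proof.
elim: c x => [|z c IHc] x; first by move=> [_ /= ->]; exact: wle_refl.
by move=> /cam_chain_cons[/cam_covers_wle xz /IHc zy]; exact: wle_trans xz zy.
Qed.

Lemma label_ge k x y : cam_covers k x y -> (k < label k x y)%N.
Proof. by move=> /cam_coversP[alx aly xy ne _]; case: (labelP xy ne alx aly) => /used_gt. Qed.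

Lemma label_first k x y : cam_covers k x y ->
  label k x y = k.+1 <-> desc (letter k) y /\ ~ desc (letter k) x.
Proof.
move=> cov; have ge := label_ge cov; have [alx aly xy ne _] := iffLR (cam_coversP _ _ _) cov.
have [ly lx minl] := labelP xy ne alx aly; split=> [e|[dy ndx]].
  by rewrite e in lx ly; split; [exact/used_first | move=> dx; apply/lx/used_first].
apply/eqP; rewrite eqn_leq ge andbT; apply: minl; first exact/used_first.
by move/used_first.
Qed.

Lemma label_gt k x y : cam_covers k x y -> desc (letter k) x -> (k.+1 < label k x y)%N.
Proof.
move=> cov dx; have := label_ge cov; rewrite leq_eqVlt => /orP[/eqP/esym|//].
by move/(label_first cov) => [_ /(_ dx)].
Qed.

Lemma all_label_gt k x y c : cam_chain k x y c -> desc (letter k) x ->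
  all (ltn k.+1) (pairmap (label k) x c).
Proof.
elim: c x => //= z c IHc x /cam_chain_cons[cov ch] dx.
rewrite label_gt //=; apply: IHc ch _; exact: wle_desc (cam_covers_wle cov) dx.
Qed.

(** Some step of the chain acquires the descent [letter k], and that step has label [k.+1]. *)
Lemma mem_first_label k x y c : cam_chain k x y c -> ~ desc (letter k) x ->
  desc (letter k) y -> k.+1 \in pairmap (label k) x c.
Proof.
elim: c x => [|z c IHc] x; first by move=> [_ /= ->].
move=> /cam_chain_cons[cov ch] ndx dy; rewrite inE; apply/orP.
have [dz|ndz] := EM (desc (letter k) z); last by right; exact: IHc.
by left; rewrite eq_sym; apply/eqP/label_first.
Qed.

Lemma cam_chain_refl k x c : cam_chain k x x c -> c = [::].
Proof.
case: c => // z c /cam_chain_cons[cov /cam_chain_wle zx].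
by case/cam_coversP: cov => _ _ xz ne _; case: ne; exact: wle_anti zx.
Qed.

Definition EL_chain k x y : Prop := exists c,
  [/\ cam_chain k x y c, sorted ltn (pairmap (label k) x c),
      forall c', cam_chain k x y c' -> sorted ltn (pairmap (label k) x c') -> c' = c &
      forall c', cam_chain k x y c' ->
        lex_le (pairmap (label k) x c) (pairmap (label k) x c')].

(* [f] is the identity or the left multiplication by a generator. *)
Lemma EL_chain_transfer k l (f : W -> W) x y : involutive f ->
  wle x y ->
  (forall a, wle x a -> wle a y -> wle (f x) (f a)) ->
  (forall a, wle (f x) (f a) -> wle (f a) (f y) -> wle x a /\ wle a y) ->
  (forall a b, wle x a -> wle a y -> wle x b -> wle b y ->
     (cam_covers k a b <-> cam_covers l (f a) (f b)) /\
     label k a b = label l (f a) (f b)) ->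
  EL_chain l (f x) (f y) -> EL_chain k x y.
Proof.
move=> fK xy fmono fin fcov; have mapK : involutive (map f) by exact: mapK.
have chainE a c : wle x a -> wle a y ->
    cam_chain k a y c <-> cam_chain l (f a) (f y) (map f c).
  elim: c a => [|b c IHc] a xa ay.
    by split=> -[_ /= e]; split=> //=; [rewrite e | exact: (can_inj fK)].
  rewrite /= !cam_chain_cons; split=> -[cov ch].
    have xb := wle_trans xa (cam_covers_wle cov); have yb := cam_chain_wle ch.
    by split; [exact/(fcov _ _ xa ay xb yb).1 | exact/IHc].
  have [xb yb] : wle x b /\ wle b y.
    apply: fin; last exact: cam_chain_wle ch.
    exact: wle_trans (fmono _ xa ay) (cam_covers_wle cov).
  by split; [exact/(fcov _ _ xa ay xb yb).1 | exact/IHc].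
have labelE a c : wle x a -> wle a y -> cam_chain k a y c ->
    pairmap (label k) a c = pairmap (label l) (f a) (map f c).
  elim: c a => //= b c IHc a xa ay /cam_chain_cons[cov ch].
  have xb := wle_trans xa (cam_covers_wle cov); have yb := cam_chain_wle ch.
  by rewrite (fcov _ _ xa ay xb yb).2 IHc.
have xx := wle_refl (x := x).
move=> [c [ch rise uniq lexf]]; exists (map f c).
have ch' : cam_chain k x y (map f c) by apply/(chainE _ _ _ xy); rewrite ?mapK.
have labc : pairmap (label k) x (map f c) = pairmap (label l) (f x) c.
  by rewrite (labelE x) // mapK.
split=> //; first by rewrite labc.
- move=> c' chc'; rewrite (labelE x) // => risec'.
  by rewrite -[c']mapK; congr map; apply: uniq => //; exact/chainE.
- by move=> c' chc'; rewrite labc (labelE x c') //; apply: lexf; exact/chainE.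
Qed.

Lemma EL_chain_skip k x y : wle x y -> avoids (letter k) y ->
  EL_chain k.+1 x y -> EL_chain k x y.
Proof.
move=> xy ay; have ale a : wle a y -> aligned k a <-> aligned k.+1 a.
  by move=> ley; apply: aligned_avoids; exact: avoids_le ay.
apply: (@EL_chain_transfer k k.+1 id) => // a b xa yya xb yb; split.
  have ea := ale a yya; have eb := ale b yb.
  rewrite !cam_coversP; split=> -[/ea ala /eb alb ab ne h]; split=> // z alz az zb;
    by apply: h => //; apply/(ale _ (wle_trans zb yb)).
congr min_nat; apply/predeqP => p /=.
have nd w : wle w y -> ~ desc (letter k) w.
  by move=> wy; apply: avoids_ndesc; exact: avoids_le ay.
by rewrite (used_skipP _ (nd a yya)) (used_skipP _ (nd b yb)).
Qed.

(** All elements of the interval have the descent [letter k], so stripping it preserves covers, and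
    position [k.+1] enters no label. *)
Lemma EL_chain_take k x y : wle x y -> desc (letter k) x ->
  EL_chain k.+1 (g (letter k) * x)%g (g (letter k) * y)%g -> EL_chain k x y.
Proof.
set s := letter k => xy dx; have dle a : wle x a -> desc s a by move=> /wle_desc; apply.
apply: (@EL_chain_transfer k k.+1 (fun w => g s * w)%g) => //.
- by move=> a; exact: gen_mulKg.
- by move=> a xa _; apply/(wle_strip dx (dle _ xa)).
- move=> a xa ay; have nda : ~ desc s (g s * a)%g.
    by move=> /ay; apply: desc_mul; exact: dle.
  have da : desc s a by rewrite -[a](gen_mulKg C s); exact: ndesc_mul.
  by split; [exact/(wle_strip dx da) | exact/(wle_strip da (dle _ xy))].
move=> a b xa _ xb _; have da := dle _ xa; have db := dle _ xb; split.
  have ea := aligned_take da; have eb := aligned_take db; have eab := wle_strip da db.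
  rewrite !cam_coversP; split=> -[/ea ala /eb alb /eab ab ne h]; split=> //.
  - by move/mulgI.
  - move=> z alz az zb; have ndz : ~ desc s z by move=> /zb; exact: desc_mul.
    have dz := ndesc_mul ndz; have [|||e|e] := h (g s * z)%g.
    + by apply/(aligned_take dz); rewrite gen_mulKg.
    + by apply/(wle_strip da dz); rewrite gen_mulKg.
    + by apply/(wle_strip dz db); rewrite gen_mulKg.
    + by left; rewrite -e gen_mulKg.
    + by right; rewrite -e gen_mulKg.
  - by move=> e; apply: ne; rewrite e.
  move=> z alz az zb; have dz := wle_desc az da.
  have [|||/mulgI e|/mulgI e] := h (g s * z)%g; try by auto.
  + exact/(aligned_take dz).
  + exact/(wle_strip da dz).
  + exact/(wle_strip dz db).
congr min_nat; apply/predeqP => p /=.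
rewrite (used_takeP _ da) (used_takeP _ db).
split=> [[[e|ub] na]|[ub na]]; first by case: na; left.
  by split=> // ua; apply: na; right.
split; first by right.
by move=> [e|//]; have := used_gt ub; lia.
Qed.

(** When the initial letter is a descent of [y] but not of [x], the rising chain begins with the
    join [z] of [x] and this letter and continues with the rising chain from [z], whose labels all
    exceed [k.+1]. *)
Theorem EL_chain_exists k x y : wle x y -> aligned k x -> aligned k y -> EL_chain k x y.
Proof.
move: k y x; apply: (@sorting_ind _ _ _ _ K) => [k|k y dy IH|k y ndy IH] x xy alx aly.
- have -> : x = 1%g by apply: (@wle_anti _ _ _ _ K) => //; exact: wle1.
  by exists [::]; split=> // c' /cam_chain_refl.
- set s := letter k in dy IH.
  have strip z : wle z y -> aligned k z -> desc s z -> EL_chain k z y.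
    move=> zy alz dz; apply: (EL_chain_take zy dz); apply: IH.
    + exact/(wle_strip dz dy).
    + exact/(aligned_take dz).
    + exact/(aligned_take dy).
  have [dx|ndx] := EM (desc s x); first exact: strip.
  have [z m zy] := exists_minub (iffRL (gen_le _ _ _) dy) xy; have [sz xz _] := m.
  have alz := aligned_join (aligned_gen (k := k) (s := s)) alx m.
  have ax := aligned_skip alx ndx.
  have dz : desc s z by exact/gen_le.
  (* An aligned element in between either has the descent [s], hence is above the join, or avoids
     [s], where [z] has only the inversions of [x]. *)
  have covz : cam_covers k x z.
    apply/cam_coversP; split=> //; first by move=> e; rewrite e in ndx.
    move=> w alw xw wz; have [dw|ndw] := EM (desc s w).
      right; apply: (@wle_anti _ _ _ _ K) => //; apply: (minub_least m) => //.
      exact/gen_le.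
    left; apply: (@wle_anti _ _ _ _ K) => // v iv.
    exact: (join_letter_parabolic ax alx m (wz _ iv) (aligned_skip alw ndw iv)).
  have lz : label k x z = k.+1 by apply/label_first.
  have first_desc w c : cam_chain k x y (w :: c) -> desc s w -> w = z.
    move=> /cam_chain_cons[/cam_coversP[_ _ xw _ h] _] dw.
    have zw : wle z w by apply: (minub_least m) => //; exact/gen_le.
    by have [e|//] := h z alz xz zw; rewrite e in dz.
  have nnil c : cam_chain k x y c -> c <> [::].
    by move=> [_ /= +] e; rewrite e /= => e2; rewrite e2 in ndx.
  have [c [ch rise uniq lexf]] := strip z zy alz dz; exists (z :: c); split.
  + exact/cam_chain_cons.
  + by rewrite /= lz (path_sortedE ltn_trans) rise andbT (all_label_gt ch).
  + case=> [|w c'] ch'; first by case: (nnil _ ch').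
    rewrite /= (path_sortedE ltn_trans) => /andP[alw risec'].
    have /cam_chain_cons[cov chc'] := ch'.
    (* Otherwise the label [k.+1] occurs later, and rising would put the first label below it,
       whereas every label exceeds [k]. *)
    have dw : desc s w.
      apply: contrapT => ndw; have := allP alw _ (mem_first_label chc' ndw dy).
      by rewrite /= ltnNge label_ge.
    have e := first_desc _ _ ch' dw; rewrite e in chc' risec' *.
    by congr cons; exact: uniq.
  case=> [|w c'] ch'; first by case: (nnil _ ch').
  have /cam_chain_cons[cov chc'] := ch'.
  (* A competitor whose first label is at most [k.+1] also starts with [z], and then the tails are
     compared. *)
  rewrite /= lex_le_cons lz label_ge //=; apply/implyP => lew.
  have e : w = z.
    apply: (first_desc _ _ ch'); apply: (iffLR (label_first cov) _).1.
    by apply/eqP; rewrite eqn_leq lew label_ge.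
  by rewrite e in chc' *; exact: lexf.
have ay := aligned_skip aly ndy; have ax := avoids_le xy ay.
apply: (EL_chain_skip xy ay); apply: IH => //.
- exact/(aligned_avoids ax).
- exact/(aligned_avoids ay).
Qed.

End CambrianIntervals.

(** * The real cosines, and the theorem *)

Section Cosines.
Variable T : realType.
Implicit Types (a h : T) (t m : nat).

Lemma chebyshev_cos h t : chebyshev (2 * cos h) t * sin h = sin (t%:R * h).
Proof.
pose f t := sin (t%:R * h); pose e t := chebyshev (2 * cos h) t * sin h.
have fSS k : f k.+2 = 2 * cos h * f k.+1 - f k.
  rewrite /f; have -> : k.+2%:R * h = k.+1%:R * h + h by rewrite -[k.+2%:R]natr1; ring.
  have -> : k%:R * h = k.+1%:R * h - h by rewrite -[k.+1%:R]natr1; ring.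
  by rewrite sinD sinB; ring.
have eSS k : e k.+2 = 2 * cos h * e k.+1 - e k by rewrite /e lin_recSS; ring.
rewrite -/(f t) -/(e t) (lin_rec_uniq fSS) (lin_rec_uniq eSS).
by congr lin_rec; rewrite /e /f /= ?mul0r ?sin0 ?mul1r.
Qed.

Lemma chebyshev2 t : chebyshev (2 : T) t = t%:R.
Proof.
rewrite [RHS](@lin_rec_uniq _ (2 : T) (fun t => t%:R)) // => k.
by rewrite -[k.+2%:R]natr1 -[k.+1%:R]natr1; ring.
Qed.

Lemma sin_angle_gt0 m t : (0 < t < m)%N -> 0 < sin (t%:R * (pi / m%:R)) :> T.
Proof.
case/andP => t0 tm; have m0 : 0 < m%:R :> T by rewrite ltr0n (leq_ltn_trans _ tm).
apply: sin_gt0_pi; apply/andP; split.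
  by rewrite mulr_gt0 ?ltr0n // divr_gt0 ?pi_gt0.
by rewrite mulrCA gtr_pMr ?pi_gt0 // ltr_pdivrMr // mul1r ltr_nat.
Qed.

Variables (W : groupType) (n : nat) (C : coxeter_system W n).

Definition cosines (i j : 'I_n) : T :=
  if cox_mx C i j == 0%N then 2 else 2 * cos (pi / (cox_mx C i j)%:R).

Lemma cosines_sym i j : cosines i j = cosines j i.
Proof. by rewrite /cosines (cox_mx_sym C). Qed.

Lemma cosines_pos i j t : i != j -> (0 < t)%N ->
  (cox_mx C i j == 0)%N || (t < cox_mx C i j)%N -> 0 < chebyshev (cosines i j) t.
Proof.
rewrite /cosines => ij t0; case: eqP => [_ _|_ /= tm].
  by rewrite chebyshev2 ltr0n.
have s1 := @sin_angle_gt0 (cox_mx C i j) 1; rewrite mul1r in s1.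
rewrite -(pmulr_lgt0 _ (s1 (leq_ltn_trans t0 tm))) chebyshev_cos.
by apply: sin_angle_gt0; rewrite t0.
Qed.

Lemma cosines_finite i j : i != j -> (cox_mx C i j != 0)%N ->
    [/\ chebyshev (cosines i j) (cox_mx C i j) = 0,
        chebyshev (cosines i j) (cox_mx C i j).+1 = -1 & cosines i j ^+ 2 != 4].
Proof.
move=> ij m0; rewrite /cosines (negPf m0); have := cox_mx_offdiag C ij.
move: (cox_mx C i j) m0 => m m0 m1; set h := pi / m%:R.
have mR : m%:R != 0 :> T by rewrite pnatr_eq0.
have sh : 0 < sin h.
  by have := @sin_angle_gt0 m 1; rewrite mul1r; apply; case: m m0 m1 {h mR} => [|[]].
have mh : m%:R * h = pi by rewrite /h mulrC divfK.
split.
- by apply: (mulIf (lt0r_neq0 sh)); rewrite chebyshev_cos mh mul0r sinpi.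
- apply: (mulIf (lt0r_neq0 sh)); rewrite chebyshev_cos -natr1 mulrDl mh mul1r mulN1r.
  by rewrite addrC sinDpi.
- have s2 : 0 < sin h ^+ 2 by rewrite exprn_gt0.
  apply/eqP; rewrite exprMn cos2sin2; lra.
Qed.

Definition cosines_matrix : cosine_matrix C T :=
  CosineMatrix cosines_sym cosines_pos cosines_finite.

End Cosines.

(** * Finiteness and maximal chains of weak order intervals *)

Section Intervals.
Variables (R : realFieldType) (W : groupType) (n : nat).
Variables (C : coxeter_system W n) (K : cosine_matrix C R).
Implicit Types (P : set W) (u v x y : W).
Local Notation le := (weak_le C).

Lemma weak_le_refl x : le x x.
Proof. exact/(wle_weak_le K)/wle_refl. Qed.

Lemma weak_le_trans y x z : le x y -> le y z -> le x z.
Proof.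
move=> /(wle_weak_le K) xy /(wle_weak_le K) yz.
exact/(wle_weak_le K)/(wle_trans xy yz).
Qed.

(** Elements below [v] have words of length at most that of [v], over a finite alphabet. *)
Lemma finite_lower_set v : finite_set [set x | le x v]%classic.
Proof.
pose f (a : (cox_length C v).-bseq 'I_n) := word_prod (cox_gen C) a.
apply: (@sub_finite_set _ _ (range f)); last exact/finite_image/finite_finset.
move=> x /= /(wle_weak_le K)/wle_length lx.
have [a ax sza] := reduced_word C x; rewrite -sza in lx.
by exists (Bseq lx).
Qed.

Lemma interval_fin_bounded P u v : P u -> P v -> le u v ->
  fin_bounded_poset (interval P le u v) le.
Proof.
move=> Pu Pv uv; split.
- by move=> x _; exact: weak_le_refl.
- move=> x y _ _ /(wle_weak_le K) xy /(wle_weak_le K); exact: wle_anti.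
- by move=> x y z _ _ _; exact: weak_le_trans.
- by apply: sub_finite_set (finite_lower_set v) => x [].
- by exists u => [|x []]; [split=> //; exact: weak_le_refl|].
- by exists v => [|x []]; [split=> //; exact: weak_le_refl|].
Qed.

(** Intervals are order convex, so covers inside a nested interval are covers in [P], and a chain of
    covers ending at [y] stays below [y]. *)
Lemma maximal_chain_interval P u v x y c :
  interval P le u v x -> interval P le u v y -> le x y ->
  maximal_chain (interval P le u v) le x y c <->
  path (fun a b => `[< covers P le a b >]) x c /\ last x c = y.
Proof.
move=> [Px ux xv] [Py uy yv] xy; rewrite /maximal_chain.
set I := interval (interval P le u v) le x y.
have coversE a b : I a -> I b -> covers I le a b <-> covers P le a b.
  move=> [[Pa ua av] xa ay] [[Pb ub bv] xb yb]; split=> -[_ _ ab ne h].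
    split=> // z Pz az zb; apply: h => //; split; first split=> //.
    - exact: weak_le_trans ua az.
    - exact: weak_le_trans zb bv.
    - exact: weak_le_trans xa az.
    - exact: weak_le_trans zb yb.
  by split=> // z [[Pz _ _] _ _]; exact: h.
have bound a d : path (fun a b => `[< covers P le a b >]) a d -> last a d = y -> le a y.
  elim: d a => [a _ /= <-|b d IHd a /= /andP[/asboolP[_ _ ab _ _] pd] ld].
    exact: weak_le_refl.
  exact: weak_le_trans ab (IHd _ pd ld).
have Ix : I x by split=> //; exact: weak_le_refl.
split=> -[pc lc]; split=> //.
  apply: sub_path pc => a b /asboolP cab; apply/asboolP.
  by have [Ia Ib _ _ _] := cab; apply/coversE.
suff key a d : I a -> path (fun a b => `[< covers P le a b >]) a d -> last a d = y ->
    path (fun a b => `[< covers I le a b >]) a d by exact: key.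
elim: d a => //= b d IHd a Ia /andP[/asboolP cab pd] ld.
have [_ Pb ab _ _] := cab; have [[Pa ua av] xa ay] := Ia; have yb := bound _ _ pd ld.
have Ib : I b.
  split; last exact: yb; first split=> //.
  - exact: weak_le_trans ua ab.
  - exact: weak_le_trans yb yv.
  - exact: weak_le_trans xa ab.
by rewrite IHd // andbT; apply/asboolP/coversE.
Qed.

End Intervals.

Theorem theorem3p7 (W : groupType) (n : nat) (C : coxeter_system W n) (u v : W)
    (hu : cambrian C u) (hv : cambrian C v) (huv : weak_le C u v) :
  EL_labeling (interval (cambrian C) (weak_le C) u v) (weak_le C)
    (cambrian_label C).
Proof.
(* The roots live over the real numbers, with the usual entries [2 * cos (pi / m)], and [2] for
   infinite order. *)
pose K := cosines_matrix Rdefinitions.R C.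
split=> [|x y Ix Iy xy]; first exact: (interval_fin_bounded K).
suff [c [ch rise uniq lexf]] : exists c,
    [/\ path (fun a b => `[< covers (cambrian C) (weak_le C) a b >]) x c /\ last x c = y,
        rising (cambrian_label C) x c,
        forall c', path (fun a b => `[< covers (cambrian C) (weak_le C) a b >]) x c' /\
          last x c' = y -> rising (cambrian_label C) x c' -> c' = c &
        forall c', path (fun a b => `[< covers (cambrian C) (weak_le C) a b >]) x c' /\
          last x c' = y ->
          lex_le (label_word (cambrian_label C) x c) (label_word (cambrian_label C) x c')].
  have chE := maximal_chain_interval K _ Ix Iy xy.
  by exists c; split=> [||c' /chE|c' /chE]; [exact/chE| |exact: uniq|exact: lexf].
(* Letters are indexed modulo a positive number of generators; with no generator the group is
   trivial and the only chain is empty. *)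
case: n C hu hv huv K Ix Iy xy => [|n'] {}C hu hv huv K Ix Iy xy.
  have all1 (w : W) : w = 1%g.
    by have [[|[]//] <-] := cox_generated C w; rewrite word_prod_nil.
  have nil (c : seq W) : path (fun a b => `[< covers (cambrian C) (weak_le C) a b >]) x c -> c = [::].
    case: c => //= z c /andP[/asboolP[_ _ _ ne _] _].
    by case: ne; rewrite (all1 x) (all1 z).
  exists [::]; split=> //; first by rewrite /= (all1 x) (all1 y).
  - by move=> c [/nil].
have camE : cambrian C = aligned K 0 by apply/predeqP => w; exact: cambrian_aligned.
have labE : cambrian_label C = label K 0.
  by apply/funext => a; apply/funext => b; rewrite /cambrian_label !(alpha_used K).
have [[alx _ _] [aly _ _]] := (Ix, Iy).
have := EL_chain_exists (iffRL (wle_weak_le K _ _) xy) (iffLR (cambrian_aligned K _) alx)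
  (iffLR (cambrian_aligned K _) aly).
by rewrite /EL_chain /cam_chain /cam_covers -labE -camE.
Qed.
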